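(* In the functional linear model with deterministic design described in the context, consider the adaptive test of $H_0:\beta=0$ that, for a given level $\bar\alpha\in(0,1)$, rejects $H_0$ when $AT_n>c_{\bar\alpha}$, $c_{\bar\alpha}=-\log(-\log(1-\bar\alpha))$. Let $k\ge1$ be a fixed but unknown integer and $\delta(n,k)=n^{-2k/(4k+1)}(\log\log n)^{k/(4k+1)}$. Suppose $k_n\asymp(\log n)^{d_0}$ for some constant $d_0\in(0,1/2)$. Furthermore, suppose $\epsilon$ is sub-Gaussian, i.e. there is a constant $C_\epsilon>0$ with $E\{\exp(t\epsilon)\}\le\exp(C_\epsilon t^2)$ for all $t\in\mathbb R$, and that $$\max_{1\le\nu\le n}\sum_{i=1}^n\omega_{i\nu}^4=o\big(n^{8/5}(\log\log n)^{-14/5}\big).$$ Then for any $\varepsilon\in(0,1)$ there exist positive constants $N_\varepsilon$ and $C_\varepsilon$ such that for any $n\ge N_\varepsilon$, $$\inf_{\substack{\|\mathfrak b\|_{\ell^2}\ge C_\varepsilon\delta(n,k)\\ \|\mathfrak b\|_{k,\ell^2}\le1}}P_{\mathfrak b}(\text{reject }H_0)\ge1-\varepsilon,$$ the infimum being over real sequences $\mathfrak b=\{b_\nu\}_{\nu\ge1}$.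
   Context: Model: $Y_i=\int_0^1X_i(t)\beta(t)dt+\epsilon_i$, $i=1,\dots,n$, with $X_i$ deterministic functions on $[0,1]$ and $\epsilon_i$ i.i.d. copies of $\epsilon$, which has mean zero and unit standard deviation. Empirical eigenfunctions: let $\widehat C(s,t)=n^{-1}\sum_{i=1}^nX_i(s)X_i(t)$, $\widehat V(\beta,\tilde\beta)=\int_0^1\int_0^1\widehat C(s,t)\beta(s)\tilde\beta(t)dsdt$, and let $\widehat\varphi_\nu$, $\nu\ge1$, be a sequence of functions on $[0,1]$, constructed from $X_1,\dots,X_n$, with $\widehat V(\widehat\varphi_\nu,\widehat\varphi_\mu)=\delta_{\nu\mu}$ for all $\nu,\mu\ge1$. Put $\omega_{i\nu}=\int_0^1X_i(t)\widehat\varphi_\nu(t)dt$ for $i=1,\dots,n$, $\nu\ge1$ (nonrandom), and $\Omega=(\omega_{i\nu})_{1\le i,\nu\le n}$, so that $\Omega^T\Omega=nI_n$. Alternatives: for a real sequence $\mathfrak b=\{b_\nu\}_{\nu\ge1}$, $\|\mathfrak b\|_{\ell^2}^2=\sum_{\nu=1}^\infty b_\nu^2$, $\|\mathfrak b\|_{k,\ell^2}^2=\sum_{\nu=1}^\infty b_\nu^2\nu^{2k}$, $\beta_{\mathfrak b}=\sum_{\nu=1}^\infty b_\nu\widehat\varphi_\nu$, and $P_{\mathfrak b}$ is the probability measure corresponding to the slope function $\beta=\beta_{\mathfrak b}$. Test statistic: for integers $j\ge1$, let $\lambda_j=c_0^{2j}n^{-4j/(4j+1)}(\log\log n)^{2j/(4j+1)}$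 with a constant $c_0>0$ not depending on $j$, $\Lambda_j=\mathrm{diag}(1^{2j},2^{2j},\dots,n^{2j})$, $d_\nu(j)=1/(1+\lambda_j\nu^{2j})$, and let $a_{il}(j)$ be the $(i,l)$ entry of $A_j=n^{-1}\Omega(I_n+\lambda_j\Lambda_j)^{-1}\Omega^T$, $1\le i,l\le n$. With $Y=(Y_1,\dots,Y_n)^T$, the penalized likelihood ratio statistic is $\mathrm{PLRT}_j=-\frac1{2n}Y^T\Omega(nI_n+n\lambda_j\Lambda_j)^{-1}\Omega^TY$, and $$\tilde\tau_j=\frac{-2n\,\mathrm{PLRT}_j-\sum_{\nu=1}^nd_\nu(j)}{(2\sum_{i\ne l}a_{il}^2(j))^{1/2}},\qquad AT_n^*=\max_{1\le j\le k_n}\tilde\tau_j,\qquad AT_n=B_n(AT_n^*-B_n),$$ where $B_n$ satisfies $2\pi B_n^2\exp(B_n^2)=k_n^2$. The notation $k_n\asymp(\log n)^{d_0}$ means that the ratio is bounded between two positive constants.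
   Formalization: V̂(φ̂_ν,φ̂_μ)=δ_νμ cannot hold for all ν,μ≥1 since V̂ has rank at most n; it is required only for ν,μ≤n, with V̂(φ̂_ν,φ̂_ν)≤1 for ν>n. X_i, φ̂_ν, β are taken square integrable and β_b as an L²-convergent series. *)

(* Defs.v *)
From HB Require Import structures.
From mathcomp Require Import all_boot all_order all_algebra.
From mathcomp Require Import all_classical all_reals all_analysis.

Set Implicit Arguments.
Unset Strict Implicit.
Unset Printing Implicit Defensive.

Import Order.TTheory GRing.Theory Num.Theory.
Import numFieldNormedType.Exports.

Local Open Scope classical_set_scope.
Local Open Scope ring_scope.

(* Sequences X, phi, b, eps are indexed from 1, as in X_1, X_2, ...; their
   value at 0 is never used.  Matrices use the 0-based type 'I_n, so the
   ordinal i stands for the index i.+1. *)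

Definition square_integrable (R : realType) (f : R -> R) : Prop :=
  measurable_fun (`[0, 1] : set R) f /\
  (@lebesgue_measure R).-integrable `[0, 1] (fun t => ((f t) ^+ 2)%:E).

Definition Chat (R : realType) (n : nat) (X : nat -> R -> R) (s t : R) : R :=
  n%:R^-1 * \sum_(1 <= i < n.+1) X i s * X i t.

Definition Vhat (R : realType) (n : nat) (X : nat -> R -> R) (f g : R -> R) : R :=
  \int[lebesgue_measure]_(t in `[0, 1])
    \int[lebesgue_measure]_(s in `[0, 1]) (Chat n X s t * f s * g t).

(* Vhat n X has rank at most n, so Vhat (phi nu) (phi mu) = delta_(nu, mu)
   cannot hold for all nu, mu >= 1.  Orthonormality is required of the first
   n functions (the columns of Omega).  Beyond n only the bound
   Vhat (phi nu) (phi nu) <= 1 is kept, which allows both normalised functions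
   and functions that are null for Vhat.  Full orthonormality would imply all
   of these conditions. *)
Definition empirical_eigenfunctions (R : realType) (n : nat)
    (X phi : nat -> R -> R) : Prop :=
  [/\ forall nu, (1 <= nu)%N -> square_integrable (phi nu),
      forall nu mu, (1 <= nu <= n)%N -> (1 <= mu <= n)%N ->
        Vhat n X (phi nu) (phi mu) = (nu == mu)%:R
    & forall nu, (n < nu)%N -> Vhat n X (phi nu) (phi nu) <= 1].

Definition omega (R : realType) (X phi : nat -> R -> R) (i nu : nat) : R :=
  \int[lebesgue_measure]_(t in `[0, 1]) (X i t * phi nu t).

Definition Omega (R : realType) (n : nat) (X phi : nat -> R -> R) : 'M[R]_n :=
  \matrix_(i < n, nu < n) omega X phi i.+1 nu.+1.

Definition l2_norm (R : realType) (b : nat -> R) : \bar R :=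
  sqrte (\sum_(1 <= nu <oo) ((b nu) ^+ 2)%:E)%E.

Definition sobolev_norm (R : realType) (k : nat) (b : nat -> R) : \bar R :=
  sqrte (\sum_(1 <= nu <oo) ((b nu) ^+ 2 * nu%:R ^+ (2 * k))%:E)%E.

(* beta = \sum_(nu >= 1) b_nu phi_nu, as a convergent series in L^2[0,1]. *)
Definition is_slope (R : realType) (phi : nat -> R -> R) (b : nat -> R)
    (beta : R -> R) : Prop :=
  square_integrable beta /\
  \int[lebesgue_measure]_(t in `[0, 1])
    ((beta t - \sum_(1 <= nu < N.+1) b nu * phi nu t) ^+ 2) @[N --> \oo] --> 0.

Definition mutually_independent (d : measure_display) (T : measurableType d)
    (R : realType) (P : probability T R) (Z : nat -> {RV P >-> R}) : Prop :=
  forall (s : seq nat) (A : nat -> set R), uniq s ->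
    (forall i, measurable (A i)) ->
    P (\big[setI/setT]_(i <- s) (Z i @^-1` A i)) =
    (\prod_(i <- s) P (Z i @^-1` A i))%E.

Definition iid_copies (d : measure_display) (T : measurableType d)
    (R : realType) (P : probability T R) (e : {RV P >-> R})
    (eps : nat -> {RV P >-> R}) : Prop :=
  mutually_independent (fun i => eps i.+1) /\
  forall i, (1 <= i)%N -> forall A : set R, measurable A ->
    distribution P (eps i) A = distribution P e A.

Definition sub_gaussian (d : measure_display) (T : measurableType d)
    (R : realType) (P : probability T R) (e : {RV P >-> R}) : Prop :=
  exists C : R, 0 < C /\
    forall t : R, ('E_P[fun w => expR (t * e w)] <= (expR (C * t ^+ 2))%:E)%E.

Definition response (R : realType) (n : nat) (T : Type) (X : nat -> R -> R)
    (beta : R -> R) (eps : nat -> T -> R) (w : T) : 'cV[R]_n :=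
  \col_(i < n) (\int[lebesgue_measure]_(t in `[0, 1]) (X i.+1 t * beta t)
                + eps i.+1 w).

Definition loglog (R : realType) (n : nat) : R := ln (ln n%:R).

Definition lambda (R : realType) (c0 : R) (n j : nat) : R :=
  c0 ^+ (2 * j) * n%:R `^ (- (4 * j%:R / (4 * j%:R + 1)))
  * loglog R n `^ (2 * j%:R / (4 * j%:R + 1)).

Definition Lambda (R : realType) (n j : nat) : 'M[R]_n :=
  diag_mx (\row_(nu < n) (nu.+1%:R ^+ (2 * j))).

Definition dcoef (R : realType) (c0 : R) (n j nu : nat) : R :=
  1 / (1 + lambda c0 n j * nu%:R ^+ (2 * j)).

Definition Amat (R : realType) (c0 : R) (n : nat) (Om : 'M[R]_n) (j : nat) :
    'M[R]_n :=
  n%:R^-1 *: (Om *m invmx (1%:M + lambda c0 n j *: Lambda R n j) *m Om^T).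

Definition PLRT (R : realType) (c0 : R) (n : nat) (Om : 'M[R]_n) (j : nat)
    (y : 'cV[R]_n) : R :=
  - (1 / (2 * n%:R)) *
  (y^T *m Om *m invmx (n%:R%:M + (n%:R * lambda c0 n j) *: Lambda R n j)
       *m Om^T *m y) 0 0.

Definition tau (R : realType) (c0 : R) (n : nat) (Om : 'M[R]_n) (y : 'cV[R]_n)
    (j : nat) : R :=
  (- 2 * n%:R * PLRT c0 Om j y - \sum_(1 <= nu < n.+1) dcoef c0 n j nu)
  / Num.sqrt (2 * \sum_(i < n) \sum_(l < n | l != i) (Amat c0 Om j i l) ^+ 2).

(* The default value tau 1 makes this the maximum over 1 <= j <= kn as soon as
   1 <= kn. *)
Definition ATstar (R : realType) (c0 : R) (n : nat) (Om : 'M[R]_n) (kn : nat)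
    (y : 'cV[R]_n) : R :=
  \big[Num.max/tau c0 Om y 1]_(1 <= j < kn.+1) tau c0 Om y j.

Definition AT (R : realType) (c0 : R) (n : nat) (Om : 'M[R]_n) (kn : nat)
    (B : R) (y : 'cV[R]_n) : R :=
  B * (ATstar c0 Om kn y - B).

(* The equation determines B up to sign; B is the nonnegative solution. *)
Definition is_normalizer (R : realType) (kn : nat) (B : R) : Prop :=
  0 <= B /\ 2 * pi * B ^+ 2 * expR (B ^+ 2) = kn%:R ^+ 2.

Definition critical_value (R : realType) (alpha : R) : R :=
  - ln (- ln (1 - alpha)).

Definition rejection_event (R : realType) (T : Type) (c0 : R) (n : nat)
    (X phi : nat -> R -> R) (kn : nat) (B alpha : R)
    (beta : R -> R) (eps : nat -> T -> R) : set T :=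
  [set w | critical_value alpha <
           AT c0 (Omega n X phi) kn B (response n X beta eps w)].

Definition delta (R : realType) (n k : nat) : R :=
  n%:R `^ (- (2 * k%:R / (4 * k%:R + 1))) * loglog R n `^ (k%:R / (4 * k%:R + 1)).

Definition log_power_growth (R : realType) (kn : nat -> nat) (d0 : R) : Prop :=
  exists c1 c2 : R, [/\ 0 < c1, 0 < c2 &
    \forall n \near \oo,
      c1 <= (kn n)%:R / (ln n%:R `^ d0) <= c2].

Definition max_fourth_moment (R : realType) (X phi : nat -> nat -> R -> R)
    (n : nat) : R :=
  \big[Num.max/0]_(1 <= nu < n.+1)
     \sum_(1 <= i < n.+1) (omega (X n) (phi n) i nu) ^+ 4.

(* Main.v *)
Require Import Defs.
From HB Require Import structures.
From mathcomp Require Import all_boot all_order all_algebra.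
From mathcomp Require Import all_classical all_reals all_analysis.
From mathcomp Require Import measurable_realfun.
From mathcomp Require Import ring lra zify.

(* Since lambda_k is tuned to the smoothness k and k <= k_n for n large, AT*_n is
   at least tau_k, and it suffices to study the single statistic tau_k.  With
   D = diag (d_nu(k)), A = n^-1 Omega D Omega^T and f the vector of the
   int X_i beta, its numerator is S + W, where S = f^T A f and
   W = 2 (A f)^T eps + (eps^T A eps - tr A) has mean zero and variance
   O(S + |A|_F^2).

   - Signal: f = Omega b + r with |r| <= 1 by the Sobolev bound on the
     coefficients beyond n, and 1 - d_nu <= lambda_k nu^(2k), so
     S >= K0 n delta(n,k)^2 with K0 as large as one wants once C is large.
   - Noise: |A|_F^2 = sum_nu d_nu^2 <= sum_nu d_nu = O((n delta^2)^2 / log log n),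
     by telescoping 1 / ((1 + h (nu - 1)) (1 + h nu)) with h^(2k) = lambda_k,
     while B_n = O(sqrt (log log n)); hence the rejection threshold for the
     numerator is O(n delta^2).  Chebyshev's inequality concludes.
   - The denominator of tau_k is positive: otherwise A, whose eigenvalues d_nu
     are distinct, would be diagonal, Omega would have a row with a single
     nonzero entry +- sqrt n, and max_nu sum_i omega_(i,nu)^4 >= n^2. *)

Set Implicit Arguments.
Unset Strict Implicit.
Unset Printing Implicit Defensive.

Import Order.TTheory GRing.Theory Num.Theory.
Import numFieldNormedType.Exports.

Local Open Scope classical_set_scope.
Local Open Scope ring_scope.

(** * Expectations of products of functions of independent random variables *)

Section independent_products.
Context d (T : measurableType d) (R : realType) (P : probability T R).

Import HBNNSimple.

Let measurable_indic_comp (Z : {RV P >-> R}) (A : set R) : measurable A ->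
  measurable_fun [set: T] (fun w => \1_A (Z w) : R).
Proof.
move=> mA; apply: (measurable_indic (U := Z @^-1` A)).
by rewrite -[_ @^-1` _]setTI; exact: measurable_funPT.
Qed.

Let integral_nnsfun_comp (Z : {RV P >-> R}) (H : T -> R)
    (h : {nnsfun R >-> R}) :
  measurable_fun [set: T] H -> (forall w, 0 <= H w) ->
  (\int[P]_w (h (Z w) * H w)%:E =
   \sum_(r \in range h) (r%:E * \int[P]_w (\1_(h @^-1` [set r]) (Z w) * H w)%:E))%E.
Proof.
move=> mH H0.
have mI r : measurable_fun [set: T]
    (fun w => (\1_(h @^-1` [set r]) (Z w) * H w)%:E).
  apply/measurable_EFinP/measurable_funM => //.
  exact: measurable_indic_comp.
transitivity (\int[P]_w (\sum_(r \in range h)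
   (r%:E * (\1_(h @^-1` [set r]) (Z w) * H w)%:E)))%E.
  apply: eq_integral => w _; rewrite EFinM [h (Z w)]fimfunE -fsumEFin//.
  rewrite ge0_mule_fsuml; last by move=> r; rewrite nnfun_muleindic_ge0.
  by apply: eq_fsbigr => r _; rewrite !EFinM muleA.
rewrite ge0_integral_fsum//.
- apply: eq_fsbigr => r; rewrite inE => -[x _ <-].
  by rewrite ge0_integralZl// => [w _|]; rewrite ?mulr_ge0 ?lee_fin ?mulr_ge0.
- by move=> r; exact: emeasurable_funM.
- by move=> r w _; rewrite EFinM muleA mule_ge0 ?nnfun_muleindic_ge0 ?lee_fin.
Qed.

(** The equality passes from indicators to simple functions by linearity over their finitely many
    values, and from there to [g] by monotone convergence along [nnsfun_approx]. *)
Lemma ge0_integral_weight_comp (Z : {RV P >-> R}) (H1 H2 : T -> R)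
    (g : R -> R) :
  measurable_fun [set: T] H1 -> (forall w, 0 <= H1 w) ->
  measurable_fun [set: T] H2 -> (forall w, 0 <= H2 w) ->
  measurable_fun [set: R] g -> (forall x, 0 <= g x) ->
  (forall A : set R, measurable A ->
    \int[P]_w (\1_A (Z w) * H1 w)%:E = \int[P]_w (\1_A (Z w) * H2 w)%:E)%E ->
  (\int[P]_w (g (Z w) * H1 w)%:E = \int[P]_w (g (Z w) * H2 w)%:E)%E.
Proof.
move=> mH1 H10 mH2 H20 mg g0 HA.
have mEg : measurable_fun [set: R] (EFin \o g) by exact/measurable_EFinP.
pose f_ := nnsfun_approx measurableT mEg.
have key (H : T -> R) : measurable_fun [set: T] H -> (forall w, 0 <= H w) ->
    (\int[P]_w (g (Z w) * H w)%:E =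
     limn (fun n => \int[P]_w (f_ n (Z w) * H w)%:E))%E.
  move=> mH H0; rewrite -monotone_convergence//.
  - apply: eq_integral => w _; apply/esym/cvg_lim => //.
    rewrite EFinM; under eq_fun do rewrite EFinM.
    apply: cvgeZr => //.
    by apply: (@cvg_nnsfun_approx _ _ _ _ measurableT _ mEg) => // x _; rewrite lee_fin.
  - move=> n; apply/measurable_EFinP/measurable_funM => //.
    exact: measurableT_comp.
  - by move=> n w _; rewrite lee_fin mulr_ge0.
  - move=> w _ a b ab; rewrite lee_fin ler_wpM2r//.
    exact/lefP/nd_nnsfun_approx.
rewrite !key//; congr (limn _); apply/funext => n.
by rewrite !integral_nnsfun_comp//; apply: eq_fsbigr => r _; rewrite HA.
Qed.

Context (Z : nat -> {RV P >-> R}).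
Hypothesis indepZ : mutually_independent Z.

Local Notation E g i := (\int[P]_w (g i (Z i w))%:E)%E.

Let measurable_comp_prod (s : seq nat) (Q : pred nat) (g : nat -> R -> R) :
  (forall i, measurable_fun [set: R] (g i)) ->
  measurable_fun [set: T] (fun w => \prod_(i <- s | Q i) g i (Z i w)).
Proof.
move=> mg; under eq_fun do rewrite -big_filter.
by apply: measurable_prod => i _; exact: measurableT_comp.
Qed.

Let integral_prod_indic (s : seq nat) (g : nat -> R -> R) : uniq s ->
  (forall i, i \in s -> exists2 A : set R, measurable A & g i = \1_A) ->
  (\int[P]_w (\prod_(i <- s) g i (Z i w))%:E = \prod_(i <- s) E g i)%E.
Proof.
move=> us hg.
have /choice[A hA] i : exists A : set R, measurable A /\ (i \in s -> g i = \1_A).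
  have [si|/negP ns] := boolP (i \in s); last by exists setT; split.
  by have [A mA ->] := hg i si; exists A.
have mA i := (hA i).1; have gA i := (hA i).2.
have mZA i : measurable (Z i @^-1` A i) by rewrite -[_ @^-1` _]setTI; exact: measurable_funPT.
transitivity (P (\big[setI/setT]_(i <- s) (Z i @^-1` A i))).
  have mB : measurable (\big[setI/setT]_(i <- s) (Z i @^-1` A i)).
    by apply: big_rec => // i B _ mB; exact: measurableI.
  rewrite -[P _]mul1e -[B in P B]setIT -integral_indic// mul1e.
  apply: eq_integral => w _; congr EFin.
  rewrite -[LHS]/((fun w => _) w); elim: (s) gA {us hg mB hA} => [|j t IH] gA.
    by rewrite !big_nil indicT.
  rewrite !big_cons indicI /= IH; last by move=> i it; apply: gA; rewrite inE it orbT.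
  by rewrite gA ?mem_head.
rewrite (indepZ)//; apply: eq_big_seq => i si; rewrite gA//.
by rewrite -[_ @^-1` _]setIT -integral_indic.
Qed.

(* Independence is given for indicators only; the indicators are exchanged for
   the functions g i one index i of t at a time. *)
Lemma ge0_integral_prod_indep (s : seq nat) (g : nat -> R -> R) : uniq s ->
  (forall i, measurable_fun [set: R] (g i)) -> (forall i x, 0 <= g i x) ->
  (forall i, E g i < +oo)%E ->
  (\int[P]_w (\prod_(i <- s) g i (Z i w))%:E = \prod_(i <- s) E g i)%E.
Proof.
move=> us.
suff main (t : seq nat) : forall g : nat -> R -> R,
    (forall i, measurable_fun [set: R] (g i)) -> (forall i x, 0 <= g i x) ->
    (forall i, E g i < +oo)%E ->
    (forall i, i \in s -> i \notin t ->
      exists2 A : set R, measurable A & g i = \1_A) ->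
    (\int[P]_w (\prod_(i <- s) g i (Z i w))%:E = \prod_(i <- s) E g i)%E.
  by move=> mg g0 gfin; apply: (main s g mg g0 gfin) => i si; rewrite si.
elim: t => {g} [|i t IH] g mg g0 gfin hg.
  by apply: integral_prod_indic => // i /hg; apply.
have [si|nis] := boolP (i \in s); last first.
  apply: IH => // j js jt; apply: hg => //; rewrite inE negb_or jt andbT.
  by apply: contraNneq nis => <-.
have Efin j : E g j \is a fin_num.
  by rewrite ge0_fin_numE// integral_ge0// => w _; rewrite lee_fin.
pose H w := \prod_(j <- s | j != i) g j (Z j w).
pose c := \prod_(j <- s | j != i) fine (E g j).
have c0 : 0 <= c.
  by apply: prodr_ge0 => j _; rewrite fine_ge0// integral_ge0// => w _; rewrite lee_fin.
have EcE : (\prod_(j <- s | j != i) E g j = c%:E)%E.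
  rewrite /c (big_morph EFin (id1 := 1%E) (op1 := *%E) EFinM)//.
  by apply: eq_bigr => j _; rewrite fineK.
transitivity (\int[P]_w (g i (Z i w) * H w)%:E)%E.
  by apply: eq_integral => w _; rewrite (bigD1_seq i).
rewrite [RHS](bigD1_seq i)//= EcE.
have H0 w : 0 <= H w by exact: prodr_ge0.
(* The weight [H], the product of the other factors, may be replaced by its mean [c] once this is
   known against every indicator of [Z i]. That case is the induction hypothesis for the family in
   which [g i] is replaced by [\1_A]. *)
rewrite (@ge0_integral_weight_comp _ H (cst c))//; last 2 first.
- exact: measurable_comp_prod.
- move=> A mA.
  pose g' j := if j == i then \1_A : R -> R else g j.
  have g'i : g' i = \1_A by rewrite /g' eqxx.
  have g'j j : j != i -> g' j = g j by rewrite /g' => /negbTE ->.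
  have EA : (\int[P]_w (\1_A (Z i w))%:E = P (Z i @^-1` A))%E.
    rewrite -[_ @^-1` _]setIT -integral_indic//.
    by rewrite -[_ @^-1` _]setTI; exact: measurable_funPT.
  have := IH g'; rewrite (bigD1_seq i)//= g'i EA.
  rewrite (eq_bigr (fun j => E g j)); last by move=> j /g'j ->.
  rewrite EcE.
  under eq_integral do rewrite (bigD1_seq i)//= g'i.
  under eq_integral => w _.
    rewrite (eq_bigr (fun j => g j (Z j w))); last by move=> j /g'j ->.
    over.
  move=> ->.
  + under [RHS]eq_integral do rewrite mulrC EFinM.
    rewrite ge0_integralZl//; first by rewrite EA muleC.
    * by apply/measurable_EFinP; exact: measurable_indic_comp.
  + by move=> j; rewrite /g'; case: ifP => // _; exact: measurable_indic.
  + by move=> j x; rewrite /g'; case: ifP.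
  + move=> j; have [->|/g'j ->//] := eqVneq j i.
    by rewrite g'i EA (le_lt_trans (probability_le1 _ _))// ?ltry//;
       rewrite -[_ @^-1` _]setTI; exact: measurable_funPT.
  + move=> j js jt; have [->|ji] := eqVneq j i; first by rewrite g'i; exists A.
    by rewrite g'j//; apply: hg => //; rewrite inE negb_or ji.
under eq_integral do rewrite /= mulrC EFinM.
rewrite ge0_integralZl//; first by rewrite muleC.
- by apply/measurable_EFinP; exact: measurableT_comp.
- by move=> w _; rewrite lee_fin.
Qed.

Let integrable_prod_indep (s : seq nat) (g : nat -> R -> R) : uniq s ->
  (forall i, measurable_fun [set: R] (g i)) ->
  (forall i, P.-integrable [set: T] (fun w => (g i (Z i w))%:E)) ->
  P.-integrable [set: T] (fun w => (\prod_(i <- s) g i (Z i w))%:E).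
Proof.
move=> us mg ig; apply/integrableP; split.
  by apply/measurable_EFinP; exact: measurable_comp_prod.
under eq_integral => w _ do rewrite /= normr_prod.
have Eabs i : (\int[P]_w (`|g i (Z i w)|)%:E < +oo)%E.
  by have /integrableP[_] := ig i.
rewrite (@ge0_integral_prod_indep s (fun i x => `|g i x|))//; last first.
  by move=> i; exact: measurableT_comp.
rewrite -ge0_fin_numE; last by apply: prode_ge0 => i _; exact: integral_ge0.
apply: (big_ind (fun x => x \is a fin_num)) => // [x y|i _]; first exact: fin_numM.
by rewrite ge0_fin_numE//; exact: integral_ge0.
Qed.

(** Both sides are additive in each factor, so a signed [g i] is split into positive and negative
    parts, one index at a time, down to the nonnegative case. *)
Lemma integral_prod_indep (s : seq nat) (g : nat -> R -> R) : uniq s ->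
  (forall i, measurable_fun [set: R] (g i)) ->
  (forall i, P.-integrable [set: T] (fun w => (g i (Z i w))%:E)) ->
  P.-integrable [set: T] (fun w => (\prod_(i <- s) g i (Z i w))%:E) /\
  (\int[P]_w (\prod_(i <- s) g i (Z i w))%:E = \prod_(i <- s) E g i)%E.
Proof.
move=> us mg ig; split; first exact: integrable_prod_indep.
(* [t] lists the indices of [s] at which [g] may still change sign. *)
suff main (t : seq nat) : forall g : nat -> R -> R,
    (forall i, measurable_fun [set: R] (g i)) ->
    (forall i, P.-integrable [set: T] (fun w => (g i (Z i w))%:E)) ->
    (forall i, i \in s -> i \notin t -> forall x, 0 <= g i x) ->
    (\int[P]_w (\prod_(i <- s) g i (Z i w))%:E = \prod_(i <- s) E g i)%E.
  by apply: (main s) => // i si; rewrite si.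
elim: t => {g mg ig} [|i t IH] g mg ig g0.
  have Eabs i : (\int[P]_w (`|g i (Z i w)|)%:E < +oo)%E.
    by have /integrableP[_] := ig i.
  have gE i : i \in s -> (fun x => `|g i x|) = g i.
    by move=> si; apply/funext => x; rewrite ger0_norm// g0.
  (* Nonnegativity is known only on [s], whereas the nonnegative case asks for it at every index;
     absolute values supply it without changing the factors in [s]. *)
  transitivity (\int[P]_w (\prod_(i <- s) `|g i (Z i w)|)%:E)%E.
    apply: eq_integral => w _; congr EFin; apply: eq_big_seq => i si.
    by rewrite -[in LHS](gE i).
  rewrite (@ge0_integral_prod_indep s (fun i x => `|g i x|))//; last first.
    by move=> i; exact: measurableT_comp.
  apply: eq_big_seq => i si; apply: eq_integral => w _.
  by rewrite -[in RHS](gE i).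
have [si|nis] := boolP (i \in s); last first.
  apply: IH => // j js jt; apply: g0 => //; rewrite inE negb_or jt andbT.
  by apply: contraNneq nis => <-.
pose G (h : R -> R) j := if j == i then h else g j.
have Gi h : G h i = h by rewrite /G eqxx.
have Gj h j : j != i -> G h j = g j by rewrite /G => /negbTE ->.
have mG h : measurable_fun [set: R] h -> forall j, measurable_fun [set: R] (G h j).
  by move=> mh j; rewrite /G; case: ifP.
pose c : \bar R := (\prod_(j <- s | j != i) E g j)%E.
have GE h : (\prod_(j <- s) E (G h) j = (\int[P]_w (h (Z i w))%:E) * c)%E.
  rewrite (bigD1_seq i)//= Gi; congr (_ * _)%E.
  by apply: eq_bigr => j ji; rewrite Gj.
have prodG h w : \prod_(j <- s) G h j (Z j w) =
    h (Z i w) * \prod_(j <- s | j != i) g j (Z j w).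
  rewrite (bigD1_seq i)//= Gi; congr (_ * _).
  by apply: eq_bigr => j ji; rewrite Gj.
pose gp x := Num.max (g i x) 0; pose gm x := Num.max (- g i x) 0.
have gB x : g i x = gp x - gm x.
  by rewrite /gp /gm; case: (lerP (g i x) 0) => ?; case: (lerP (- g i x) 0) => ?; lra.
have mgp : measurable_fun [set: R] gp by exact: measurable_maxr.
have mgm : measurable_fun [set: R] gm.
  by apply: measurable_maxr => //; exact: measurableT_comp.
have igp : P.-integrable [set: T] (fun w => (gp (Z i w))%:E).
  apply: le_integrable (ig i) => //.
    by apply/measurable_EFinP; exact: measurableT_comp.
  by move=> w _; rewrite lee_fin /gp; case: (lerP (g i (Z i w)) 0); rewrite ?normr0.
have igm : P.-integrable [set: T] (fun w => (gm (Z i w))%:E).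
  apply: le_integrable (ig i) => //.
    by apply/measurable_EFinP; exact: measurableT_comp.
  by move=> w _; rewrite lee_fin /gm; case: (lerP (- g i (Z i w)) 0); rewrite ?normr0 ?normrN.
have iG h : P.-integrable [set: T] (fun w => (h (Z i w))%:E) ->
    forall j, P.-integrable [set: T] (fun w => (G h j (Z j w))%:E).
  by move=> ih j; have [->|/Gj ->//] := eqVneq j i; rewrite Gi.
have GG : G (g i) = g by apply/funext => j; rewrite /G; case: eqP => // ->.
have Efin h : P.-integrable [set: T] (fun w => (h (Z i w))%:E) ->
    (\int[P]_w (h (Z i w))%:E)%E \is a fin_num.
  by move=> ih; exact: integrable_fin_num.
have G0 h : (forall x, 0 <= h x) ->
    forall j, j \in s -> j \notin t -> forall x, 0 <= G h j x.
  move=> h0 j sj tj x; have [->|ji] := eqVneq j i; first by rewrite Gi.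
  by rewrite Gj// g0// inE negb_or ji.
have gp0 x : 0 <= gp x by rewrite le_max lexx orbT.
have gm0 x : 0 <= gm x by rewrite le_max lexx orbT.
have cfin : c \is a fin_num.
  apply: (big_ind (fun x => x \is a fin_num)) => // [x y|j _]; first exact: fin_numM.
  exact: integrable_fin_num.
transitivity (\int[P]_w (\prod_(j <- s) G gp j (Z j w) - \prod_(j <- s) G gm j (Z j w))%:E)%E.
  by apply: eq_integral => w _; rewrite !prodG -mulrBl -gB -prodG GG.
under eq_integral do rewrite EFinB.
rewrite integralB_EFin//; last 2 first.
- by apply: integrable_prod_indep => //; [exact: mG|exact: iG].
- by apply: integrable_prod_indep => //; [exact: mG|exact: iG].
rewrite !IH//; try by [exact: mG|exact: iG|exact: G0].
rewrite !GE -muleBl ?fin_num_adde_defl//; last by rewrite fin_numN Efin.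
rewrite -integralB_EFin// -[in RHS]GG GE; congr (_ * c)%E.
by apply: eq_integral => w _; rewrite gB.
Qed.

End independent_products.

Lemma Rintegral_sum d (T : measurableType d) (R : realType)
    (mu : {measure set T -> \bar R}) (D : set T) (I : eqType) (s : seq I)
    (h : I -> T -> R) : measurable D ->
  (forall i, i \in s -> mu.-integrable D (EFin \o h i)) ->
  mu.-integrable D (EFin \o (fun x => \sum_(i <- s) h i x)) /\
  \int[mu]_(x in D) (\sum_(i <- s) h i x) = \sum_(i <- s) \int[mu]_(x in D) h i x.
Proof.
move=> mD; elim: s => [_|i s IH ih].
  rewrite big_nil; split.
    by under eq_fun do rewrite big_nil; exact: integrable0.
  by under eq_Rintegral do rewrite big_nil; rewrite Rintegral_cst// mul0r.
have [|IH1 IH2] := IH; first by move=> j js; apply: ih; rewrite inE js orbT.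
have ii := ih i (mem_head i s).
rewrite big_cons -IH2 -RintegralD//; split.
  have := integrableD mD ii IH1; apply: eq_integrable => // w _ /=.
  by rewrite big_cons EFinD.
by apply: eq_Rintegral => w _; rewrite big_cons.
Qed.

(** * Second moment of a centred quadratic polynomial in independent variables *)

Section second_moment.
Context d (T : measurableType d) (R : realType) (P : probability T R).

Local Notation int f := (P.-integrable [set: T] (EFin \o f)).
Local Notation EE f := (\int[P]_w f w).

(** Pythagoras: after expanding the square, orthogonality kills every cross term. *)
Lemma orthogonal_second_moment (I : finType) (U : I -> T -> R) (c : I -> R)
    (K : R) :
  (forall p q, int (fun w => U p w * U q w)) ->
  (forall p q, p != q -> EE (fun w => U p w * U q w) = 0) ->
  (forall p, EE (fun w => U p w ^+ 2) <= K) ->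
  int (fun w => (\sum_p c p * U p w) ^+ 2) /\
  EE (fun w => (\sum_p c p * U p w) ^+ 2) <= K * \sum_p c p ^+ 2.
Proof.
move=> iU oU UK.
have E w : (\sum_p c p * U p w) ^+ 2 =
    \sum_p \sum_q c p * c q * (U p w * U q w).
  rewrite expr2 big_distrl /=; apply: eq_bigr => p _.
  by rewrite big_distrr /=; apply: eq_bigr => q _; rewrite mulrACA.
have i1 p q : int (fun w => c p * c q * (U p w * U q w)).
  have := integrableZl measurableT (c p * c q) (iU p q).
  by apply: eq_integrable => // w _ /=; rewrite EFinM.
have i2 p := Rintegral_sum (s := index_enum I) measurableT (fun q _ => i1 p q).
have [i3 E3] := Rintegral_sum (s := index_enum I) measurableT (fun p _ => (i2 p).1).
split.
  by apply: eq_integrable i3 => // w _ /=; rewrite E.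
under eq_Rintegral do rewrite E.
rewrite E3 mulr_sumr; apply: ler_sum => p _.
rewrite (i2 p).2 (bigD1 p)//= big1 => [|q qp]; last first.
  by rewrite RintegralZl// oU 1?eq_sym// mulr0.
rewrite addr0 RintegralZl// -expr2 mulrC ler_wpM2r ?sqr_ge0//.
by under eq_Rintegral do rewrite -expr2.
Qed.

Context (Z : nat -> {RV P >-> R}) (K : R).
Hypothesis indepZ : mutually_independent Z.
Hypothesis intZ : forall i p, (p <= 4)%N -> int (fun w => Z i w ^+ p).
Hypothesis EZ1 : forall i, EE (Z i) = 0.
Hypothesis EZ2 : forall i, EE (fun w => Z i w ^+ 2) = 1.
Hypothesis EZ4 : forall i, EE (fun w => Z i w ^+ 4) <= K.
Hypothesis K1 : 1 <= K.

(* By independence the mean factors over the distinct indices, so an index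
   occurring exactly once contributes a factor 'E[Z m] = 0. *)
Let monomial (ks : seq nat) : (size ks <= 4)%N ->
  int (fun w => \prod_(k <- ks) Z k w) /\
  (forall m, count_mem m ks = 1%N -> EE (fun w => \prod_(k <- ks) Z k w) = 0).
Proof.
move=> ks4.
have c4 m : (count_mem m ks <= 4)%N by exact: leq_trans (count_size _ _) ks4.
have mx p : measurable_fun [set: R] (fun x : R => x ^+ p) by exact: exprn_measurable.
have [|i|i|I1 I2] := integral_prod_indep (s := undup ks)
    (g := fun i x => x ^+ count_mem i ks) indepZ.
- exact: undup_uniq.
- exact: mx.
- exact: intZ.
split.
  by apply: eq_integrable I1 => // w _ /=; rewrite prodr_undup_exp_count.
move=> m km; under eq_Rintegral do rewrite -prodr_undup_exp_count.
rewrite /Rintegral I2 (bigD1_seq m) ?undup_uniq//=; last first.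
  by rewrite mem_undup -has_pred1 has_count km.
suff -> : (\int[P]_w (Z m w ^+ count_mem m ks)%:E = 0)%E by rewrite mul0e.
rewrite km -[LHS]fineK; first by rewrite -[fine _]/(EE (fun w => Z m w ^+ 1)) EZ1.
by apply: integrable_fin_num => //; exact: (@intZ m 1).
Qed.

Let linear_part n (v : 'I_n -> R) :
  int (fun w => (\sum_i v i * Z i w) ^+ 2) /\
  EE (fun w => (\sum_i v i * Z i w) ^+ 2) <= \sum_i v i ^+ 2.
Proof.
rewrite -[X in _ <= X]mul1r.
apply: (orthogonal_second_moment (U := fun (i : 'I_n) w => Z i w)) => [p q|p q pq|p].
- have [+ _] := monomial (ks := [:: p : nat; q : nat]) isT.
  by apply: eq_integrable => // w _ /=; rewrite !big_cons big_nil mulr1.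
- have [_ /(_ p)] := monomial (ks := [:: p : nat; q : nat]) isT.
  under eq_Rintegral do rewrite !big_cons big_nil mulr1.
  by apply; rewrite /= eqxx eq_sym (inj_eq val_inj) (negbTE pq).
- by rewrite EZ2.
Qed.

(** The variables [Z i ^+ 2 - 1] are centred and independent, hence orthogonal, and their second
    moment is the fourth moment of [Z i] minus 1. *)
Let diag_part n (a : 'I_n -> R) :
  int (fun w => (\sum_i a i * (Z i w ^+ 2 - 1)) ^+ 2) /\
  EE (fun w => (\sum_i a i * (Z i w ^+ 2 - 1)) ^+ 2) <= K * \sum_i a i ^+ 2.
Proof.
have i2 i := @intZ i 2 isT; have i4 i := @intZ i 4 isT.
have i0 : int (fun=> 1) by exact: finite_measure_integrable_cst.
have i21 i : int (fun w => Z i w ^+ 2 - 1).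
  have := integrableB measurableT (i2 i) i0.
  by apply: eq_integrable => // w _ /=; rewrite EFinB.
have E21 i : EE (fun w => Z i w ^+ 2 - 1) = 0.
  by rewrite RintegralB// EZ2 Rintegral_cst//= probability_setT/= mulr1 subrr.
have E22 i : int (fun w => (Z i w ^+ 2 - 1) ^+ 2) /\
    EE (fun w => (Z i w ^+ 2 - 1) ^+ 2) <= K.
  have E w : (Z i w ^+ 2 - 1) ^+ 2 = Z i w ^+ 4 + ((- 2) * (Z i w ^+ 2 - 1) - 1).
    by ring.
  have j1 : int (fun w => (- 2) * (Z i w ^+ 2 - 1)).
    have := integrableZl measurableT (- 2) (i21 i).
    by apply: eq_integrable => // w _ /=; rewrite EFinM.
  have j2 : int (fun w => (- 2) * (Z i w ^+ 2 - 1) - 1).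
    have := integrableB measurableT j1 i0.
    by apply: eq_integrable => // w _ /=; rewrite EFinB.
  split.
    have := integrableD measurableT (i4 i) j2.
    by apply: eq_integrable => // w _ /=; rewrite E EFinD.
  under eq_Rintegral do rewrite E.
  rewrite RintegralD// RintegralB// RintegralZl// E21 Rintegral_cst//=.
  by rewrite probability_setT/=; have := EZ4 i; lra.
have prod2 (p q : 'I_n) : p != q ->
    int (fun w => (Z p w ^+ 2 - 1) * (Z q w ^+ 2 - 1)) /\
    EE (fun w => (Z p w ^+ 2 - 1) * (Z q w ^+ 2 - 1)) = 0.
  move=> pq.
  have [|i|i|I1 I2] := integral_prod_indep (s := [:: p : nat; q : nat])
      (g := fun i x => x ^+ 2 - 1) indepZ.
  - by rewrite /= inE (inj_eq val_inj) pq.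
  - by apply: measurable_funB => //; exact: exprn_measurable.
  - exact: i21.
  split.
    by apply: eq_integrable I1 => // w _ /=; rewrite !big_cons big_nil mulr1.
  move: I2; under eq_integral do rewrite !big_cons big_nil mulr1.
  rewrite /Rintegral => ->; rewrite !big_cons big_nil mule1.
  suff -> : (\int[P]_w (Z p w ^+ 2 - 1)%:E = 0)%E by rewrite mul0e.
  rewrite -[LHS]fineK; last by apply: integrable_fin_num => //; exact: i21.
  by rewrite -[fine _]/(EE (fun w => Z p w ^+ 2 - 1)) E21.
apply: (orthogonal_second_moment (U := fun (i : 'I_n) w => Z i w ^+ 2 - 1)).
- move=> p q; have [->|/prod2[]//] := eqVneq p q.
  by have [+ _] := E22 q; apply: eq_integrable => // w _ /=; rewrite expr2.
- by move=> p q /prod2[].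
- by move=> p; have [] := E22 p.
Qed.

(** The products [Z i * Z l] over pairs with [i < l] form an orthonormal family. *)
Let upper_part n (a : 'I_n -> 'I_n -> R) :
  int (fun w => (\sum_(i < n) \sum_(l < n | (i < l)%N) a i l * (Z i w * Z l w)) ^+ 2) /\
  EE (fun w => (\sum_(i < n) \sum_(l < n | (i < l)%N) a i l * (Z i w * Z l w)) ^+ 2)
    <= \sum_(i < n) \sum_(l < n | (i < l)%N) a i l ^+ 2.
Proof.
(* Setting [U] and [c] to 0 off the pairs with [i < l] turns the triangular sum into a sum over the
   finite type of all pairs. *)
pose U (p : 'I_n * 'I_n) w := if (p.1 < p.2)%N then Z p.1 w * Z p.2 w else 0.
pose c (p : 'I_n * 'I_n) := if (p.1 < p.2)%N then a p.1 p.2 else 0.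
have E w : \sum_(i < n) \sum_(l < n | (i < l)%N) a i l * (Z i w * Z l w) =
    \sum_p c p * U p w.
  rewrite pair_big_dep /= big_mkcond; apply: eq_bigr => -[i l] _ /=.
  by rewrite /c /U /=; case: ifP => // _; rewrite mul0r.
have E2 : \sum_(i < n) \sum_(l < n | (i < l)%N) a i l ^+ 2 = \sum_p c p ^+ 2.
  rewrite pair_big_dep /= big_mkcond; apply: eq_bigr => -[i l] _ /=.
  by rewrite /c /=; case: ifP => // _; rewrite expr0n.
rewrite E2 -[X in _ <= X]mul1r.
suff [h1 h2] : int (fun w => (\sum_p c p * U p w) ^+ 2) /\
    EE (fun w => (\sum_p c p * U p w) ^+ 2) <= 1 * \sum_p c p ^+ 2.
  split; last by under eq_Rintegral do rewrite E.
  by apply: eq_integrable h1 => // w _ /=; rewrite E.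
have i0 : int (fun=> 0) by exact: integrable0.
have U4 (p q : 'I_n * 'I_n) : (p.1 < p.2)%N -> (q.1 < q.2)%N ->
    forall w, U p w * U q w =
    \prod_(k <- [:: p.1 : nat; p.2 : nat; q.1 : nat; q.2 : nat]) Z k w.
  by move=> pp qq w; rewrite /U pp qq !big_cons big_nil mulr1 !mulrA.
apply: orthogonal_second_moment => [p q|p q pq|p].
- have [pp|pp] := boolP (p.1 < p.2)%N; last first.
    by apply: eq_integrable i0 => // w _ /=; rewrite /U (negbTE pp) mul0r.
  have [qq|qq] := boolP (q.1 < q.2)%N; last first.
    by apply: eq_integrable i0 => // w _ /=; rewrite /U (negbTE qq) mulr0.
  have [+ _] := monomial (ks := [:: p.1 : nat; p.2 : nat; q.1 : nat; q.2 : nat]) isT.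
  by apply: eq_integrable => // w _ /=; rewrite -U4.
- have [pp|pp] := boolP (p.1 < p.2)%N; last first.
    under eq_Rintegral do rewrite /U (negbTE pp) mul0r.
    by rewrite Rintegral_cst// mul0r.
  have [qq|qq] := boolP (q.1 < q.2)%N; last first.
    under eq_Rintegral do rewrite /U (negbTE qq) mulr0.
    by rewrite Rintegral_cst// mul0r.
  have [_ H] := monomial (ks := [:: p.1 : nat; p.2 : nat; q.1 : nat; q.2 : nat]) isT.
  under eq_Rintegral do rewrite U4//.
  move: p q pq pp qq H {U4} => [i l] [i' l'] /= pq pp qq H.
  (* Two distinct increasing pairs share at most one index, so [i] or [l] occurs exactly once among
     the four and [monomial] gives mean zero. *)
  have : (count_mem (i : nat) [:: i : nat; l : nat; i' : nat; l' : nat] == 1)%N ||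
         (count_mem (l : nat) [:: i : nat; l : nat; i' : nat; l' : nat] == 1)%N.
    have : ~~ (((i : nat) == i') && ((l : nat) == l')) by [].
    by rewrite /= !eqxx; lia.
  by case/orP => /eqP; exact: H.
- have [pp|pp] := boolP (p.1 < p.2)%N; last first.
    under eq_Rintegral do rewrite /U (negbTE pp) expr0n/=.
    by rewrite Rintegral_cst// mul0r ler01.
  under eq_Rintegral do rewrite /U pp exprMn.
  have [|i|i|_ I2] := integral_prod_indep (s := [:: p.1 : nat; p.2 : nat])
      (g := fun i x => x ^+ 2) indepZ.
  + by rewrite /= inE neq_ltn pp.
  + exact: exprn_measurable.
  + exact: (@intZ i 2).
  have Zfin i : (\int[P]_w (Z i w ^+ 2)%:E = 1)%E.
    rewrite -[LHS]fineK; last exact: integrable_fin_num (@intZ i 2 isT).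
    by rewrite -[fine _]/(EE (fun w => Z i w ^+ 2)) EZ2.
  move: I2; under eq_integral do rewrite !big_cons big_nil mulr1.
  by rewrite /Rintegral => ->; rewrite !big_cons big_nil !Zfin !mule1.
Qed.


(** [W] splits into a linear part, a diagonal part and the two strict triangles. The square of a sum
    of four terms is at most 4 times the sum of the squares, and each part is bounded separately. *)
Lemma quadratic_form_second_moment n (A : 'M[R]_n) (v : 'I_n -> R) :
  let W w := \sum_i v i * Z i w +
    (\sum_i \sum_l A i l * (Z i w * Z l w) - \tr A) in
  int (fun w => W w ^+ 2) /\
  EE (fun w => W w ^+ 2) <=
    4 * \sum_i v i ^+ 2 + 4 * K * \sum_i \sum_l A i l ^+ 2.
Proof.
move=> W.
have [i1 e1] := linear_part v.
have [i2 e2] := diag_part (fun i => A i i).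
have [i3 e3] := upper_part (fun i l => A i l).
have [i4 e4] := upper_part (fun i l => A l i).
pose w1 w := \sum_i v i * Z i w.
pose w2 w := \sum_i A i i * (Z i w ^+ 2 - 1).
pose w3 w := \sum_(i < n) \sum_(l < n | (i < l)%N) A i l * (Z i w * Z l w).
pose w4 w := \sum_(i < n) \sum_(l < n | (i < l)%N) A l i * (Z i w * Z l w).
have split_sum (F : 'I_n -> 'I_n -> R) : \sum_i \sum_l F i l =
    \sum_i F i i + \sum_(i < n) \sum_(l < n | (i < l)%N) F i l +
    \sum_(i < n) \sum_(l < n | (i < l)%N) F l i.
  rewrite [X in _ = _ + X](exchange_big_dep xpredT)//= -!big_split /=.
  apply: eq_bigr => i _.
  rewrite (bigD1 i)//= -addrA; congr (_ + _).
  rewrite (bigID (fun l : 'I_n => (i < l)%N))/=; congr (_ + _); apply: eq_bigl => l.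
    by rewrite -(inj_eq val_inj) /=; case: ltngtP.
  by rewrite -(inj_eq val_inj) /=; case: ltngtP.
have WE w : W w = w1 w + w2 w + w3 w + w4 w.
  rewrite /W split_sum -/(w1 w) -/(w3 w).
  have -> : \sum_(i < n) \sum_(l < n | (i < l)%N) A l i * (Z l w * Z i w) = w4 w.
    by apply: eq_bigr => i _; apply: eq_bigr => l _; rewrite (mulrC (Z l w)).
  have -> : w2 w = \sum_i A i i * (Z i w * Z i w) - \tr A.
    by rewrite /mxtrace -sumrB; apply: eq_bigr => i _; rewrite mulrBr mulr1 expr2.
  by ring.
have mZ i : measurable_fun [set: T] (Z i) by [].
have mW : measurable_fun [set: T] W.
  apply: measurable_funD.
    by apply: measurable_sum => i; exact: measurable_funM.
  apply: measurable_funB => //.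
  apply: measurable_sum => i; apply: measurable_sum => l.
  by apply: measurable_funM => //; exact: measurable_funM.
pose Q w := 4 * (w1 w ^+ 2 + w2 w ^+ 2 + w3 w ^+ 2 + w4 w ^+ 2).
have iD f g : int f -> int g -> int (fun w => f w + g w).
  move=> If Ig; have := integrableD measurableT If Ig.
  by apply: eq_integrable => // w _ /=; rewrite EFinD.
have i12 := iD _ _ i1 i2.
have i123 := iD _ _ i12 i3.
have i1234 := iD _ _ i123 i4.
have iQ : int Q.
  have := integrableZl measurableT 4 i1234.
  by apply: eq_integrable => // w _ /=; rewrite -EFinM.
have WQ w : W w ^+ 2 <= Q w.
  rewrite WE /Q.
  by have := sqr_ge0 (w1 w - w2 w); have := sqr_ge0 (w3 w - w4 w);
     have := sqr_ge0 (w1 w + w2 w - w3 w - w4 w); rewrite !expr2; nra.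
have iW : int (fun w => W w ^+ 2).
  apply: le_integrable iQ => //.
    by apply/measurable_EFinP; exact: measurable_funX.
  by move=> w _; rewrite lee_fin ger0_norm ?sqr_ge0// (le_trans (WQ w)) ?ler_norm.
split=> //; apply: (@le_trans _ _ (EE Q)); first exact: le_Rintegral.
rewrite RintegralZl// !RintegralD// (split_sum (fun i l => A i l ^+ 2)).
have S3 : 0 <= \sum_(i < n) \sum_(l < n | (i < l)%N) A i l ^+ 2.
  by do 2 apply: sumr_ge0 => ? _; exact: sqr_ge0.
have S4 : 0 <= \sum_(i < n) \sum_(l < n | (i < l)%N) A l i ^+ 2.
  by do 2 apply: sumr_ge0 => ? _; exact: sqr_ge0.
(* The triangles carry the constant 1; [1 <= K] raises it to [K], so that they combine with the
   diagonal into the full Frobenius norm. *)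
move: (ler_peMl S3 K1) (ler_peMl S4 K1) e1 e2 e3 e4.
rewrite -/w1 -/w2 -/w3 -/w4 -mulrA !mulrDr; lra.
Qed.

End second_moment.

(** * Moments of sub-Gaussian errors and a Chebyshev bound *)

Section subgaussian_errors.
Context d (T : measurableType d) (R : realType) (P : probability T R).

Local Notation int f := (P.-integrable [set: T] (EFin \o f)).
Local Notation EE f := (\int[P]_w f w).

(** Both expectations are integrals of [g] against the common law. This carries the moments of [e]
    over to each copy [eps i]. *)
Lemma eq_distribution_integral (X Y : {RV P >-> R}) (g : R -> R) :
  (forall A : set R, measurable A -> distribution P X A = distribution P Y A) ->
  measurable_fun [set: R] g -> int (g \o Y) ->
  int (g \o X) /\ EE (g \o X) = EE (g \o Y).
Proof.
move=> XY mg igY.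
have mEg : measurable_fun [set: R] (EFin \o g) by exact/measurable_EFinP.
have igX : int (g \o X).
  apply/integrableP; split.
    by apply/measurable_EFinP; exact: measurableT_comp.
  have /integrableP[_] := igY.
  have mn : measurable_fun [set: R] (fun x => (`|g x|)%:E).
    by apply/measurable_EFinP; exact: measurableT_comp.
  rewrite -(ge0_integral_distribution Y mn)//.
  rewrite -(ge0_integral_distribution X mn)//.
  by rewrite (eq_measure_integral (distribution P X)) // => A mA _; exact/esym/XY.
split=> //; rewrite /Rintegral; congr fine.
rewrite -(integral_distribution (X := X) mEg)// -(integral_distribution (X := Y) mEg)//.
by apply: eq_measure_integral => A mA _; exact: XY.
Qed.

Lemma sub_gaussian_int_exp (e : {RV P >-> R}) t : sub_gaussian e ->
  int (fun w => expR (t * e w)).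
Proof.
move=> [C [_ /(_ t)]]; rewrite unlock => eC; apply/integrableP; split.
  apply/measurable_EFinP; apply: measurableT_comp => //.
  exact: measurable_funM.
apply: le_lt_trans (ltry _); apply: le_trans eC.
by under eq_integral do rewrite /= ger0_norm ?expR_ge0//.
Qed.

(** Domination: |x|^p <= 1 + x^4 <= 24 exp |x| <= 24 (exp x + exp (-x)), the middle inequality
    coming from the fourth-order term of the exponential series. *)
Lemma sub_gaussian_int_pow (e : {RV P >-> R}) p : sub_gaussian e -> (p <= 4)%N ->
  int (fun w => e w ^+ p).
Proof.
move=> sg p4.
have i1 := sub_gaussian_int_exp 1 sg.
have i2 := sub_gaussian_int_exp (-1) sg.
have i12 : int (fun w => 24 * (expR (1 * e w) + expR (-1 * e w))).
  have := integrableZl measurableT 24 (integrableD measurableT i1 i2).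
  by apply: eq_integrable => // w _ /=; rewrite EFinM EFinD.
apply: le_integrable i12 => //.
  by apply/measurable_EFinP; exact: measurable_funX.
move=> w _; rewrite lee_fin mul1r mulN1r; set x := e w.
rewrite [X in _ <= X]ger0_norm; last by rewrite mulr_ge0// addr_ge0// expR_ge0.
rewrite normrX; have [y yE] : exists y : R, y = `|x| by exists `|x|.
rewrite -yE; have y0 : 0 <= y by rewrite yE.
have yp : y ^+ p <= 1 + y ^+ 4.
  have [y1|/ltW y1] := lerP y 1.
    by apply: (@le_trans _ _ 1); rewrite ?exprn_ile1// lerDl exprn_ge0.
  by apply: (@le_trans _ _ (y ^+ 4)); rewrite ?ler_weXn2l// lerDr.
have ye : expR y <= expR x + expR (- x).
  by rewrite yE; case: (ger0P x) => _; rewrite ?lerDl ?lerDr ?expR_ge0.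
have y24 : 1 + y ^+ 4 / 24 <= expR y by exact: (expR_ge1Dxn 3 y0).
have y40 : 0 <= y ^+ 4 by exact: exprn_ge0.
by lra.
Qed.

Context (e : {RV P >-> R}) (eps : nat -> {RV P >-> R}).
Hypothesis heps : iid_copies e eps.
Hypothesis hmean : ('E_P[e] = 0)%E.
Hypothesis hsd : (sqrte 'V_P[e] = 1)%E.
Hypothesis hsub : sub_gaussian e.

(** Chebyshev's inequality for the second moment bounded above. [K] depends only on the fourth
    moment of [e], so one value serves every [n], [A] and [v]. *)
Lemma quadratic_form_lower_tail : exists2 K : R, 1 <= K &
  forall n (A : 'M[R]_n) (v : 'I_n -> R) (a : R), 0 < a ->
  (P [set w | (\sum_i v i * eps i.+1 w +
      (\sum_i \sum_l A i l * (eps i.+1 w * eps l.+1 w) - \tr A) <= - a)%R]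
   <= ((4 * \sum_i v i ^+ 2 + 4 * K * \sum_i \sum_l A i l ^+ 2) / a ^+ 2)%:E)%E.
Proof.
have ei p : (p <= 4)%N -> int (fun w => e w ^+ p) by exact: sub_gaussian_int_pow.
have mx p : measurable_fun [set: R] (fun x : R => x ^+ p) by exact: exprn_measurable.
have tr i p : (p <= 4)%N -> int (fun w => eps i.+1 w ^+ p) /\
    EE (fun w => eps i.+1 w ^+ p) = EE (fun w => e w ^+ p).
  move=> p4.
  exact: (eq_distribution_integral (g := fun x => x ^+ p) (heps.2 i.+1 isT) (mx p) (ei p p4)).
have E1 : EE e = 0 by move: hmean; rewrite unlock /Rintegral => ->.
have E2 : EE (fun w => e w ^+ 2) = 1.
  move: hsd; rewrite /variance unlock hmean /= unlock.
  rewrite (_ : (\int[P]_w _)%E = (\int[P]_w (e w ^+ 2)%:E)%E); last first.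
    by apply: eq_integral => w _; rewrite mulrfctE /= !subr0 expr2.
  rewrite -[(\int[P]_w _)%E]fineK; last by apply: integrable_fin_num => //; exact: ei.
  rewrite -[fine _]/(EE (fun w => e w ^+ 2)) /= => -[] /(congr1 (fun x => x ^+ 2)).
  by rewrite sqr_sqrtr ?expr1n// Rintegral_ge0// => w _; exact: sqr_ge0.
pose K := 1 + `|EE (fun w => e w ^+ 4)|.
have K1 : 1 <= K by rewrite lerDl.
exists K => // n A v a a0.
(* The errors are numbered from 1, while the independent family is indexed from 0. *)
pose Z i := eps i.+1.
have iZ : forall i p, (p <= 4)%N -> int (fun w => Z i w ^+ p).
  by move=> i p /(tr i)[].
have EZ1 i : EE (Z i) = 0.
  have [_ h] := tr i 1 isT.
  by rewrite -[LHS]/(EE (fun w => eps i.+1 w ^+ 1)) h; exact: E1.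
have EZ2 i : EE (fun w => Z i w ^+ 2) = 1.
  by have [_ ->] := tr i 2 isT.
have EZ4 i : EE (fun w => Z i w ^+ 4) <= K.
  have [_ ->] := tr i 4 isT; rewrite /K.
  by have := ler_norm (EE (fun w => e w ^+ 4)); lra.
pose W w := \sum_i v i * Z i w + (\sum_i \sum_l A i l * (Z i w * Z l w) - \tr A).
have [iW EW] : int (fun w => W w ^+ 2) /\ EE (fun w => W w ^+ 2) <=
    4 * \sum_i v i ^+ 2 + 4 * K * \sum_i \sum_l A i l ^+ 2.
  by have [] := quadratic_form_second_moment heps.1 iZ EZ1 EZ2 EZ4 K1 A v.
have mW : measurable_fun [set: T] W.
  apply: measurable_funD.
    by apply: measurable_sum => i; exact: measurable_funM.
  apply: measurable_funB => //.
  apply: measurable_sum => i; apply: measurable_sum => l.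
  by apply: measurable_funM => //; exact: measurable_funM.
rewrite -[[set w | _]]/[set w | W w <= - a].
set S := [set w | _].
have mS : measurable S.
  by rewrite -[S]setTI; apply: measurable_fun_le => //.
rewrite -[P S]fineK ?fin_num_measure// lee_fin ler_pdivlMr ?exprn_gt0//.
apply: le_trans EW.
rewrite -lee_fin EFinM fineK ?fin_num_measure//.
rewrite /Rintegral fineK; last exact: integrable_fin_num.
rewrite -[S in P S]setIT -integral_indic// muleC.
have mI : measurable_fun [set: T] (fun w => (\1_S w : R)%:E).
  by apply/measurable_EFinP; exact: measurable_indic.
rewrite -ge0_integralZl ?lee_fin ?sqr_ge0//.
apply: ge0_le_integral => //.
- by move=> w _; rewrite -EFinM lee_fin mulr_ge0 ?sqr_ge0.
- exact: emeasurable_funM.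
- by apply/measurable_EFinP; exact: measurable_funX.
move=> w _; rewrite -EFinM lee_fin indicE.
have [|] := boolP (w \in S); last by rewrite mulr0 sqr_ge0.
rewrite inE mulr1 => wS; have {wS}Wa : W w <= - a by [].
by rewrite -(sqrrN (W w)) ler_sqr ?nnegrE; lra.
Qed.

End subgaussian_errors.

(** * Spectral algebra of the smoothing matrix A = n^-1 Omega D Omega^T *)

Section smoothing_matrix.
Context (R : realType) (n : nat) (Om : 'M[R]_n) (dd : 'rV[R]_n).
Hypothesis n0 : (0 < n)%N.
Hypothesis OmO : Om^T *m Om = n%:R%:M.
Hypothesis dd01 : forall nu, 0 < dd 0 nu <= 1.

Let A : 'M[R]_n := n%:R^-1 *: (Om *m diag_mx dd *m Om^T).

Let nR0 : n%:R != 0 :> R. Proof. by rewrite pnatr_eq0 -lt0n. Qed.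

(** For a square matrix a left inverse is also a right inverse. *)
Let OmOt : Om *m Om^T = n%:R%:M.
Proof.
have : (n%:R^-1 *: Om^T) *m Om = 1%:M.
  by rewrite -scalemxAl OmO scale_scalar_mx mulVf.
move/mulmx1C; rewrite -scalemxAr => /(congr1 (fun M => n%:R *: M)).
by rewrite scalerA mulfV// scale1r scale_scalar_mx mulr1.
Qed.

Lemma smoothing_sym : A^T = A.
Proof. by rewrite /A linearZ/= !trmx_mul trmxK tr_diag_mx mulmxA. Qed.

Lemma smoothing_trace : \tr A = \sum_nu dd 0 nu.
Proof.
rewrite /A mxtraceZ mxtrace_mulC mulmxA OmO mul_scalar_mx mxtraceZ mulrA mulVf//.
by rewrite mul1r mxtrace_diag.
Qed.

Lemma smoothing_mulA : A *m A =
  n%:R^-1 *: (Om *m diag_mx (\row_nu (dd 0 nu ^+ 2)) *m Om^T).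
Proof.
rewrite /A -scalemxAl -scalemxAr scalerA.
rewrite -!mulmxA [Om^T *m _]mulmxA OmO mul_scalar_mx -!scalemxAr scalerA.
rewrite -mulrA mulVf// mulr1; congr (_ *: _); congr (_ *m _).
rewrite mulmxA; congr (_ *m _); by rewrite mulmx_diag.
Qed.

(** By symmetry the left side is tr (A A), and the trace is cyclic. *)
Lemma smoothing_frobenius : \sum_i \sum_l A i l ^+ 2 = \sum_nu dd 0 nu ^+ 2.
Proof.
transitivity (\tr (A *m A)).
  apply: eq_bigr => i _; rewrite mxE; apply: eq_bigr => l _.
  by have /matrixP/(_ l i) := smoothing_sym; rewrite mxE => <-; rewrite expr2.
rewrite smoothing_mulA mxtraceZ mxtrace_mulC mulmxA OmO mul_scalar_mx mxtraceZ.
rewrite mulrA mulVf// mul1r mxtrace_diag.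
by apply: eq_bigr => nu _; rewrite mxE.
Qed.

Lemma smoothing_form (d' : 'rV[R]_n) (f : 'cV[R]_n) :
  (f^T *m (n%:R^-1 *: (Om *m diag_mx d' *m Om^T)) *m f) 0 0 =
  n%:R^-1 * \sum_nu d' 0 nu * (Om^T *m f) nu 0 ^+ 2.
Proof.
rewrite -scalemxAr -scalemxAl mxE; congr (_ * _).
have -> : f^T *m (Om *m diag_mx d' *m Om^T) *m f =
    (Om^T *m f)^T *m (diag_mx d' *m (Om^T *m f)).
  by rewrite trmx_mul trmxK !mulmxA.
set g := Om^T *m f; rewrite mul_diag_mx mxE; apply: eq_bigr => nu _.
by move: g => g; rewrite !mxE; ring.
Qed.

(** The left side is f^T A^2 f, and A^2 has eigenvalues d^2 <= d. The variance of the linear noise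
    is thereby controlled by the signal itself. *)
Lemma smoothing_drift (f : 'cV[R]_n) :
  \sum_i (A *m f) i 0 ^+ 2 <= (f^T *m A *m f) 0 0.
Proof.
have -> : \sum_i (A *m f) i 0 ^+ 2 = (f^T *m (A *m A) *m f) 0 0.
  rewrite mulmxA -mulmxA -[f^T *m A]trmxK trmx_mul trmxK smoothing_sym mxE.
  by apply: eq_bigr => i _; rewrite [in RHS]mxE expr2.
rewrite smoothing_mulA !smoothing_form ler_pM2l ?invr_gt0 ?ltr0n//.
apply: ler_sum => nu _; rewrite ler_wpM2r ?sqr_ge0// mxE expr2.
by have /andP[d0 d1] := dd01 nu; rewrite ger_pMr.
Qed.

(** Coordinatewise, with x = b_nu and rho the coordinate of Omega^T r, one has D (n x + rho)^2 >=
    n^2 D x^2 / 2 - rho^2. This follows from D (n x + 2 rho)^2 >= 0 and D <= 1. *)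
Lemma smoothing_signal (b : 'cV[R]_n) (r : 'cV[R]_n) :
  forall f, f = Om *m b + r ->
  n%:R / 2 * \sum_nu dd 0 nu * b nu 0 ^+ 2 - \sum_i r i 0 ^+ 2 <=
  (f^T *m A *m f) 0 0.
Proof.
move=> f fE; rewrite /A smoothing_form.
have -> : Om^T *m f = n%:R *: b + Om^T *m r.
  by rewrite fE mulmxDr mulmxA OmO mul_scalar_mx.
have nn : 0 < n%:R :> R by rewrite ltr0n.
(* Omega^T / sqrt n is an isometry. *)
have -> : \sum_i r i 0 ^+ 2 = n%:R^-1 * \sum_nu (Om^T *m r) nu 0 ^+ 2.
  have E (m : nat) (u : 'cV[R]_m) : \sum_i u i 0 ^+ 2 = (u^T *m u) 0 0.
    by rewrite mxE; apply: eq_bigr => i _; rewrite mxE expr2.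
  rewrite !E trmx_mul trmxK -mulmxA (mulmxA Om) OmOt mul_scalar_mx -scalemxAr.
  have S a (M : 'M[R]_1) : (a *: M) 0 0 = a * M 0 0 by rewrite mxE.
  by rewrite S mulrA mulVf// mul1r.
rewrite !mulr_sumr -sumrB; apply: ler_sum => nu _.
set rho := (_ *m _) _ _.
have -> : (n%:R *: b + Om^T *m r) nu 0 = n%:R * b nu 0 + rho.
  by rewrite [LHS]mxE [(n%:R *: b) _ _]mxE.
have /andP[d0 d1] := dd01 nu.
set D := dd 0 nu in d0 d1 *; set x := b nu 0.
rewrite -(ler_pM2l nn) mulrBr !mulrA mulfV// !mul1r.
have : 0 <= D * (n%:R * x + 2 * rho) ^+ 2 by rewrite mulr_ge0 ?sqr_ge0 ?ltW.
have : D * rho ^+ 2 <= rho ^+ 2 by rewrite ler_piMl ?sqr_ge0.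
by set N := n%:R; lra.
Qed.

(* A Omega = Omega D, so a diagonal A makes each row of Omega an eigenvector of D. *)
Lemma smoothing_diagonal_row : injective (dd 0) ->
  (forall i l, l != i -> A i l = 0) ->
  exists nu, n%:R ^+ 2 <= \sum_i Om i nu ^+ 4.
Proof.
move=> dinj Adiag.
have AO : A *m Om = Om *m diag_mx dd.
  by rewrite /A -scalemxAl -mulmxA OmO mul_mx_scalar scalerA mulVf// scale1r.
pose i0 := Ordinal n0.
have E nu : A i0 i0 * Om i0 nu = Om i0 nu * dd 0 nu.
  have /matrixP/(_ i0 nu) := AO; rewrite mul_mx_diag.
  rewrite [X in X = _ -> _]mxE [X in _ = X -> _]mxE => <-.
  rewrite (bigD1 i0)//= big1 ?addr0// => l li.
  by rewrite Adiag ?mul0r.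
have row_norm : \sum_nu Om i0 nu ^+ 2 = n%:R.
  have /matrixP/(_ i0 i0) := OmOt; rewrite !mxE eqxx mulr1n => <-.
  by apply: eq_bigr => nu _; rewrite mxE expr2.
have /existsP[nu nu0] : [exists nu, Om i0 nu != 0].
  apply: contraT; rewrite negb_exists => /forallP h.
  have := nR0; rewrite -row_norm big1 ?eqxx// => nu _.
  by have := h nu; rewrite negbK => /eqP ->; rewrite expr0n.
(* Every nonzero entry of row [i0] forces its [dd] to equal [A i0 i0]. Since [dd 0] is injective
   there is only one such entry, and it carries the whole squared norm [n] of the row. *)
have Ad : A i0 i0 = dd 0 nu by apply: (mulIf nu0); rewrite E mulrC.
have onu : Om i0 nu ^+ 2 = n%:R.
  rewrite -row_norm (bigD1 nu)//= big1 ?addr0// => mu munu.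
  have [->|mu0] := eqVneq (Om i0 mu) 0; first by rewrite expr0n.
  have : A i0 i0 = dd 0 mu by apply: (mulIf mu0); rewrite E mulrC.
  by rewrite Ad => /dinj /eqP; rewrite eq_sym (negbTE munu).
exists nu; rewrite (bigD1 i0)//= -onu -exprM lerDl.
by apply: sumr_ge0 => i _; rewrite exprn_even_ge0.
Qed.

End smoothing_matrix.

(** * The penalized likelihood ratio as a quadratic form *)

Section statistic.
Context (R : realType) (n : nat) (Om : 'M[R]_n) (c0 : R) (j : nat).
Hypothesis n0 : (0 < n)%N.
Hypothesis lam0 : 0 < lambda c0 n j.

Let lam := lambda c0 n j.
Definition dcoef_row : 'rV[R]_n := \row_(nu < n) dcoef c0 n j nu.+1.

Let den_gt0 (nu : nat) : 0 < 1 + lam * nu%:R ^+ (2 * j).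
Proof. by rewrite ltr_pwDl// mulr_ge0 ?exprn_ge0// ltW. Qed.

Lemma dcoef_row_gt0_le1 nu : 0 < dcoef_row 0 nu <= 1.
Proof.
rewrite mxE /dcoef -/lam; apply/andP; split; first exact: divr_gt0.
rewrite ler_pdivrMr// mul1r lerDl.
by rewrite mulr_ge0 ?exprn_ge0// ltW.
Qed.

Let mul_den_dcoef_row : (1%:M + lam *: Lambda R n j) *m diag_mx dcoef_row = 1%:M.
Proof.
apply/matrixP => i l; rewrite mul_mx_diag !mxE.
have [->|il] := eqVneq i l; last by rewrite !mulr0n mulr0 addr0 mul0r.
by rewrite !mulr1n /dcoef -/lam mul1r mulfV// gt_eqF// den_gt0.
Qed.

Let unitmx_den : 1%:M + lam *: Lambda R n j \in unitmx.
Proof. by have [] := mulmx1_unit mul_den_dcoef_row. Qed.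

Let invmx_den : invmx (1%:M + lam *: Lambda R n j) = diag_mx dcoef_row.
Proof. by rewrite -[RHS](mulKmx unitmx_den) mul_den_dcoef_row mulmx1. Qed.

Lemma AmatE : Amat c0 Om j = n%:R^-1 *: (Om *m diag_mx dcoef_row *m Om^T).
Proof. by rewrite /Amat invmx_den. Qed.

(** The inverted matrix in [PLRT] is [n] times the one in [Amat]; the scalar factors then cancel. *)
Lemma PLRTE (y : 'cV[R]_n) :
  - 2 * n%:R * PLRT c0 Om j y = (y^T *m Amat c0 Om j *m y) 0 0.
Proof.
have nR0 : n%:R != 0 :> R by rewrite pnatr_eq0 -lt0n.
have E : n%:R%:M + (n%:R * lam) *: Lambda R n j =
    n%:R *: (1%:M + lam *: Lambda R n j).
  by rewrite scalerDr scalerA scale_scalar_mx mulr1.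
rewrite /PLRT -/lam E invmxZ; last by rewrite unitmxZ ?unitfE.
rewrite invmx_den AmatE -!scalemxAr -!scalemxAl !mulmxA.
have S a (M : 'M[R]_1) : (a *: M) 0 0 = a * M 0 0 by rewrite mxE.
by rewrite !S; field.
Qed.

(** The powers nu^(2j) are distinct for j > 0. This is the simplicity of the spectrum that
    [smoothing_diagonal_row] asks for. *)
Lemma dcoef_row_inj : (0 < j)%N -> injective (dcoef_row 0).
Proof.
move=> j0 nu mu; rewrite !mxE /dcoef -/lam => h.
have {h} : lam * nu.+1%:R ^+ (2 * j) = lam * mu.+1%:R ^+ (2 * j).
  by apply: (addrI 1); apply: invr_inj; move: h; rewrite !div1r.
move/(mulfI (lt0r_neq0 lam0))/eqP; rewrite eqrXn2 ?muln_gt0// eqr_nat => /eqP[].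
exact: val_inj.
Qed.

End statistic.

Lemma quadratic_expand (R : realType) n (A : 'M[R]_n) (f u : 'cV[R]_n) : A^T = A ->
  ((f + u)^T *m A *m (f + u)) 0 0 = (f^T *m A *m f) 0 0 +
   (\sum_i (2 * (A *m f) i 0) * u i 0 + \sum_i \sum_l A i l * (u i 0 * u l 0)).
Proof.
move=> As.
have E (a b : 'cV[R]_n) : (a^T *m A *m b) 0 0 = \sum_i a i 0 * (A *m b) i 0.
  by rewrite -mulmxA mxE; apply: eq_bigr => i _; rewrite mxE.
have C (a b : 'cV[R]_n) : (a^T *m A *m b) 0 0 = (b^T *m A *m a) 0 0.
  have <- : ((b^T *m A *m a)^T) 0 0 = (b^T *m A *m a) 0 0 by rewrite mxE.
  by rewrite !trmx_mul trmxK As mulmxA.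
have -> : (f + u)^T = f^T + u^T by rewrite linearD.
rewrite !mulmxDl !mulmxDr.
have D (M N : 'M[R]_1) : (M + N) 0 0 = M 0 0 + N 0 0 by rewrite mxE.
rewrite !D (C f u) (E u f) (E u u).
have -> : \sum_i \sum_l A i l * (u i 0 * u l 0) = \sum_i u i 0 * (A *m u) i 0.
  apply: eq_bigr => i _; rewrite mxE mulr_sumr; apply: eq_bigr => l _; by ring.
have -> : \sum_i (2 * (A *m f) i 0) * u i 0 = 2 * \sum_i u i 0 * (A *m f) i 0.
  rewrite mulr_sumr; apply: eq_bigr => l _; by ring.
by ring.
Qed.

(** Cauchy-Schwarz through Lagrange's identity: the double sum of (x_i y_j - x_j y_i)^2 is twice the
    difference of the two sides. *)
Lemma sum_mul_sqr_le (R : realFieldType) (I : Type) (s : seq I) (x y : I -> R) :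
  (\sum_(i <- s) x i * y i) ^+ 2 <=
  (\sum_(i <- s) x i ^+ 2) * (\sum_(i <- s) y i ^+ 2).
Proof.
have E (u v : I -> R) : (\sum_(i <- s) u i) * (\sum_(i <- s) v i) =
    \sum_(i <- s) \sum_(j <- s) u i * v j.
  by rewrite big_distrl; apply: eq_bigr => i _; rewrite big_distrr.
have : 0 <= \sum_(i <- s) \sum_(j <- s) (x i * y j - x j * y i) ^+ 2.
  by do 2 apply: sumr_ge0 => ? _; exact: sqr_ge0.
have -> : \sum_(i <- s) \sum_(j <- s) (x i * y j - x j * y i) ^+ 2 =
    (\sum_(i <- s) x i ^+ 2) * (\sum_(i <- s) y i ^+ 2)
    - 2 * (\sum_(i <- s) x i * y i) ^+ 2
    + (\sum_(i <- s) y i ^+ 2) * (\sum_(i <- s) x i ^+ 2).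
  rewrite expr2 !E mulr_sumr -sumrB -big_split /=; apply: eq_bigr => i _.
  rewrite mulr_sumr -sumrB -big_split /=; apply: eq_bigr => j _.
  by ring.
by rewrite [X in _ + X]mulrC; lra.
Qed.

(** * Square-integrable functions, the covariance form and the slope series *)

Section square_integrable_functions.
Context d (T : measurableType d) (R : realType) (mu : {measure set T -> \bar R}).
Context (D : set T).
Hypothesis mD : measurable D.
Local Notation int f := (mu.-integrable D (EFin \o f)).
Local Notation I01 f := (\int[mu]_(t in D) f t).

Local Notation L2 f :=
  (measurable_fun D f /\ mu.-integrable D (fun t => ((f t) ^+ 2)%:E)).

Let intZ (c : R) h : int h -> int (fun t => c * h t).
Proof.
move=> ih; have := integrableZl mD c ih.
by apply: eq_integrable => // t _ /=; rewrite EFinM.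
Qed.

Let eq_L2 (f g : T -> R) : f =1 g -> L2 f -> L2 g.
Proof. by move=> /funext ->. Qed.

Lemma square_integrable_mul (f g : T -> R) :
  L2 f -> L2 g -> int (fun t => f t * g t).
Proof.
move=> [mf If] [mg Ig].
apply: le_integrable (integrableD mD If Ig) => //.
  by apply/measurable_EFinP; exact: measurable_funM.
move=> t _ /=; rewrite lee_fin normrM.
rewrite [X in _ <= X]ger0_norm ?addr_ge0 ?sqr_ge0//.
rewrite -(real_normK (num_real (f t))) -(real_normK (num_real (g t))).
have := sqr_ge0 (`|f t| - `|g t|); have := sqr_ge0 (`|f t| + `|g t|).
by rewrite sqrrB sqrrD; lra.
Qed.

Lemma square_integrableD (f g : T -> R) : L2 f ->
  L2 g -> L2 (fun t => f t + g t).
Proof.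
move=> hf hg; have [mf If] := hf; have [mg Ig] := hg; split.
  exact: measurable_funD.
have If2 : int (fun t => f t ^+ 2) by exact: If.
have := integrableD mD (integrableD mD If Ig)
  (integrableZl mD 2 (square_integrable_mul hf hg)).
apply: eq_integrable => // t _ /=.
by rewrite -EFinM -!EFinD; congr EFin; ring.
Qed.

Lemma square_integrableZ (c : R) (f : T -> R) : L2 f ->
  L2 (fun t => c * f t).
Proof.
move=> [mf If]; split; first exact: measurable_funM.
have := integrableZl mD (c ^+ 2) If.
by apply: eq_integrable => // t _ /=; rewrite -EFinM exprMn.
Qed.

Lemma square_integrable_sum (I : eqType) (s : seq I) (c : I -> R)
    (f : I -> T -> R) : (forall i, i \in s -> L2 (f i)) ->
  L2 (fun t => \sum_(i <- s) c i * f i t).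
Proof.
elim: s => [_|i s IH h].
  under eq_fun do rewrite big_nil; split; first exact: measurable_cst.
  rewrite (_ : (fun t => _) = cst 0%E); first exact: integrable0.
  by apply/funext => t; rewrite big_nil expr0n.
apply: (eq_L2 (f := fun t => c i * f i t + \sum_(j <- s) c j * f j t)) => [t|].
  by rewrite big_cons.
apply: square_integrableD.
  by apply: square_integrableZ; apply: h; exact: mem_head.
by apply: IH => j js; apply: h; rewrite inE js orbT.
Qed.

(** The kernel is a finite sum of products, so linearity separates the two integrals. *)
Lemma Rintegral_covariance (I : eqType) (s : seq I) (X : I -> T -> R) (c : R)
    (f g : T -> R) :
  (forall i, i \in s -> L2 (X i)) -> L2 f -> L2 g ->
  I01 (fun t => I01 (fun u => c * (\sum_(i <- s) X i u * X i t) * f u * g t)) =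
  c * \sum_(i <- s) I01 (fun t => X i t * f t) * I01 (fun t => X i t * g t).
Proof.
move=> hX hf hg.
have If i : i \in s -> int (fun t => X i t * f t).
  by move=> /hX hi; exact: square_integrable_mul.
have Ig i : i \in s -> int (fun t => X i t * g t).
  by move=> /hX hi; exact: square_integrable_mul.
transitivity (I01 (fun t => \sum_(i <- s)
    (c * I01 (fun u => X i u * f u)) * (X i t * g t))).
  apply: eq_Rintegral => t _.
  transitivity (I01 (fun u => \sum_(i <- s) (c * (X i t * g t)) * (X i u * f u))).
    apply: eq_Rintegral => u _; rewrite -2!mulrA !mulr_suml.
    by rewrite mulr_sumr; apply: eq_bigr => i _; ring.
  have [|_ ->] := Rintegral_sum (s := s) (mu := mu)
     (h := fun i u => (c * (X i t * g t)) * (X i u * f u)) mD.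
    by move=> i hi; exact/intZ/If.
  rewrite big_seq [RHS]big_seq; apply: eq_bigr => i hi.
  by rewrite RintegralZl//; [ring|exact: If].
have [|_ ->] := Rintegral_sum (s := s) (mu := mu)
    (h := fun i t => (c * I01 (fun u => X i u * f u)) * (X i t * g t)) mD.
  by move=> i hi; exact/intZ/Ig.
rewrite mulr_sumr big_seq [RHS]big_seq; apply: eq_bigr => i hi.
by rewrite RintegralZl ?mulrA//; exact: Ig.
Qed.

(** Convergence in mean square implies convergence of inner products with a fixed square-integrable
    [x]. *)
Lemma inner_product_slope (phi : nat -> T -> R) (b : nat -> R) (beta x : T -> R) :
  (forall nu, (1 <= nu)%N -> L2 (phi nu)) ->
  L2 x -> L2 beta ->
  I01 (fun t => (beta t - \sum_(1 <= nu < N.+1) b nu * phi nu t) ^+ 2)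
    @[N --> \oo] --> 0 ->
  \sum_(1 <= nu < N.+1) b nu * I01 (fun t => x t * phi nu t) @[N --> \oo]
    --> I01 (fun t => x t * beta t).
Proof.
move=> hphi hx hbeta cvgb.
pose S N t := \sum_(1 <= nu < N.+1) b nu * phi nu t.
have hnu N nu : nu \in index_iota 1 N.+1 -> L2 (phi nu).
  by rewrite mem_index_iota => /andP[/hphi].
have hS N : L2 (S N) by apply: square_integrable_sum; exact: hnu.
have hh N : L2 (fun t => beta t - S N t).
  apply: eq_L2 (square_integrableD hbeta (square_integrableZ (-1) (hS N))) => t.
  by rewrite mulN1r.
have ES N : I01 (fun t => x t * S N t) =
    \sum_(1 <= nu < N.+1) b nu * I01 (fun t => x t * phi nu t).
  transitivity (I01 (fun t => \sum_(1 <= nu < N.+1) b nu * (x t * phi nu t))).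
    by apply: eq_Rintegral => t _; rewrite mulr_sumr; apply: eq_bigr => nu _; ring.
  have Ip nu : nu \in index_iota 1 N.+1 -> int (fun t => x t * phi nu t).
    by move=> /hnu hp; exact: square_integrable_mul.
  have [|_ ->] := Rintegral_sum (s := index_iota 1 N.+1) (mu := mu)
      (h := fun nu t => b nu * (x t * phi nu t)) mD.
    by move=> nu /Ip; exact: intZ.
  rewrite big_seq [RHS]big_seq; apply: eq_bigr => nu hi.
  by rewrite RintegralZl//; exact: Ip.
have Ixx : int (fun t => x t ^+ 2) by have [] := hx.
have xx0 : 0 <= I01 (fun t => x t ^+ 2) by apply: Rintegral_ge0 => t _; exact: sqr_ge0.
have bound N (s : R) : 0 < s ->
    `|I01 (fun t => x t * beta t) - I01 (fun t => x t * S N t)| <=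
    s * I01 (fun t => x t ^+ 2) + s^-1 * I01 (fun t => (beta t - S N t) ^+ 2).
  (* |x h| <= s x^2 + h^2 / s *)
  move=> s0.
  have Ih2 : int (fun t => (beta t - S N t) ^+ 2) by have [] := hh N.
  have Ixh := square_integrable_mul hx (hh N).
  rewrite -RintegralB//; [|exact: square_integrable_mul..].
  rewrite -RintegralZl// -[X in _ + X]RintegralZl// -RintegralD//; [|exact: intZ..].
  under eq_Rintegral do rewrite -mulrBr.
  apply: (le_trans (le_normr_Rintegral mD Ixh)).
  apply: le_Rintegral => //.
  - exact: integrable_norm.
  - have := integrableD mD (intZ s Ixx) (intZ s^-1 Ih2).
    by apply: eq_integrable => // t _ /=; rewrite EFinD.
  move=> t _; set y := beta t - S N t.
  rewrite normrM -(real_normK (num_real (x t))) -(real_normK (num_real y)).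
  have [a aE] : exists a : R, a = `|x t| by exists `|x t|.
  have [c cE] : exists c : R, c = `|y| by exists `|y|.
  have a0 : 0 <= a by rewrite aE.
  have c0 : 0 <= c by rewrite cE.
  rewrite -aE -cE.
  have := sqr_ge0 (s * a - c); rewrite sqrrB exprMn => h.
  rewrite -(ler_pM2l s0) mulrDr !mulrA mulfV ?gt_eqF// mul1r.
  have : 0 <= s * a * c by rewrite !mulr_ge0// ltW.
  by move: h; rewrite -mulr_natr; lra.
under eq_fun do rewrite -ES.
apply/cvgrPdist_le => /= ep ep0.
(* This weight keeps the first term of [bound] below [ep / 2], the added 1 making the divisor
   positive. The second term is below [ep / 2] once the squared error is at most [ep / 2 * s]. *)
pose s := ep / 2 / (I01 (fun t => x t ^+ 2) + 1).
have s0 : 0 < s by rewrite !divr_gt0// ltr_wpDl.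
have e1 : 0 < ep / 2 * s by rewrite mulr_gt0// divr_gt0.
move/cvgrPdist_le : cvgb => /(_ _ e1); apply: filterS => N.
rewrite sub0r normrN => hN; apply: le_trans (bound N s s0) _.
have : s * I01 (fun t => x t ^+ 2) <= ep / 2.
  by rewrite /s mulrAC ler_pdivrMr ?ltr_wpDl// ler_wpM2l ?divr_ge0 ?ltW// ltrDl.
have : s^-1 * I01 (fun t => (beta t - S N t) ^+ 2) <= ep / 2.
  rewrite mulrC ler_pdivrMr//; apply: le_trans hN; exact: ler_norm.
by lra.
Qed.

End square_integrable_functions.

(** * Head and tail of a sequence in the Sobolev ball *)

Section sequence_norms.
Context (R : realType) (k : nat) (b : nat -> R).
Hypothesis hsob : (sobolev_norm k b <= 1)%E.

Lemma sqrte_le1 (x : \bar R) : (0 <= x -> sqrte x <= 1 -> x <= 1)%E.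
Proof.
case: x => [r| |]//=; rewrite !lee_fin => r0 h.
by rewrite -(sqr_sqrtr r0) -[X in _ <= X](expr1n _ 2) ler_sqr ?nnegrE ?sqrtr_ge0.
Qed.

Lemma sobolev_partial_sum m n :
  \sum_(m.+1 <= nu < n) b nu ^+ 2 * nu%:R ^+ (2 * k) <= 1.
Proof.
have t0 nu : 0 <= b nu ^+ 2 * nu%:R ^+ (2 * k) by rewrite mulr_ge0 ?sqr_ge0// exprn_ge0.
have H : (\sum_(1 <= nu <oo) ((b nu) ^+ 2 * nu%:R ^+ (2 * k))%:E <= 1)%E.
  by apply: sqrte_le1 => //; apply: nneseries_ge0 => nu _ _; rewrite lee_fin.
rewrite -lee_fin; apply: le_trans H; rewrite -sumEFin.
have [nm|mn] := leqP n m.+1.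
  by rewrite big_geq//; apply: nneseries_ge0 => nu _ _; rewrite lee_fin.
apply: (@le_trans _ _ (\sum_(1 <= nu < n) (b nu ^+ 2 * nu%:R ^+ (2 * k))%:E)%E).
  rewrite [X in (_ <= X)%E](@big_cat_nat _ _ _ m.+1)//=; last exact: ltnW.
  by rewrite leeDr// sume_ge0// => nu _; rewrite lee_fin.
by apply: nneseries_lim_ge => nu _ _; rewrite lee_fin.
Qed.

(** For nu > n, b_nu^2 <= n^(-2k) b_nu^2 nu^(2k), so the Sobolev bound leaves at most n^(-2k) of the
    squared norm beyond [n]. *)
Lemma l2_norm_head (a : R) n : (0 < n)%N -> 0 <= a -> (a%:E <= l2_norm b)%E ->
  a ^+ 2 <= \sum_(1 <= nu < n.+1) b nu ^+ 2 + (n%:R ^+ (2 * k))^-1.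
Proof.
move=> n0 a0; rewrite /l2_norm; set S := (\sum_(1 <= nu <oo) _)%E => aS.
have SN : (S <= (\sum_(1 <= nu < n.+1) b nu ^+ 2 + (n%:R ^+ (2 * k))^-1)%:E)%E.
  apply: lime_le.
    by apply: is_cvg_nneseries => nu _ _; rewrite lee_fin sqr_ge0.
  exists n.+1 => // N /= nN; rewrite sumEFin lee_fin.
  rewrite (@big_cat_nat _ _ _ n.+1)//= lerD2l.
  have nk0 : 0 < n%:R ^+ (2 * k) :> R by rewrite exprn_gt0// ltr0n.
  rewrite -[X in _ <= X]mul1r ler_pdivlMr//.
  apply: le_trans (sobolev_partial_sum n N); rewrite mulr_suml !big_nat.
  apply: ler_sum => nu /andP[nnu _]; rewrite ler_wpM2l ?sqr_ge0// lerXn2r ?nnegrE//.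
  by rewrite ler_nat ltnW.
have S0 : (0 <= S)%E by apply: nneseries_ge0 => nu _ _; rewrite lee_fin sqr_ge0.
case: S S0 SN aS => [r| |]//=; rewrite !lee_fin => r0 rN ar.
by apply: le_trans rN; rewrite -(sqr_sqrtr r0) ler_sqr ?nnegrE ?sqrtr_ge0.
Qed.

End sequence_norms.

(** Telescoping of 1 / nu^2 <= 1 / (nu - 1) - 1 / nu; the induction keeps the term 1 / N that is
    dropped at the end. *)
Lemma sum_inv_sqr_tail (R : realFieldType) (n N : nat) : (0 < n)%N ->
  \sum_(n.+1 <= nu < N.+1) (nu%:R ^+ 2)^-1 <= n%:R^-1 :> R.
Proof.
move=> n0; have [Nn|nN] := leqP N n.
  by rewrite big_geq// invr_ge0.
suff : \sum_(n.+1 <= nu < N.+1) (nu%:R ^+ 2)^-1 <= n%:R^-1 - N%:R^-1 :> R.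
  by move/le_trans; apply; rewrite lerBlDr lerDl invr_ge0.
rewrite -(@subnKC n.+1 N)//; elim: (N - n.+1)%N => [|m IH].
  rewrite addn0 big_nat1.
  have x0 : 0 < n%:R :> R by rewrite ltr0n.
  rewrite -natr1; set x := n%:R in x0 *.
  have -> : x^-1 - (x + 1)^-1 = (x * (x + 1))^-1 by field; lra.
  rewrite lef_pV2 ?posrE ?mulr_gt0 ?exprn_gt0//; nra.
rewrite addnS big_nat_recr/=; last by lia.
apply: le_trans (lerD IH (lexx _)) _.
have x0 : 0 < (n.+1 + m)%:R :> R by rewrite ltr0n.
rewrite -[(n.+1 + m).+1%:R]natr1; set x := (n.+1 + m)%:R in x0 *.
rewrite -addrA lerD2l.
have -> : (x + 1) ^- 2 = (x * (x + 1))^-1 - ((x * (x + 1))^-1 - (x + 1) ^- 2) by ring.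
have -> : (x * (x + 1))^-1 = x^-1 - (x + 1)^-1 by field; lra.
have : (x + 1) ^- 2 <= x^-1 - (x + 1)^-1; last by lra.
have -> : x^-1 - (x + 1)^-1 = (x * (x + 1))^-1 by field; lra.
rewrite lef_pV2 ?posrE ?mulr_gt0 ?exprn_gt0//; nra.
Qed.

(** * The design matrix and the response to a slope in the Sobolev ball *)

Section design.
Context (R : realType) (n : nat) (X phi : nat -> R -> R).
Hypothesis n0 : (0 < n)%N.
Hypothesis hX : forall i, (1 <= i <= n)%N -> square_integrable (X i).
Hypothesis hphi : empirical_eigenfunctions n X phi.

Let nR0 : n%:R != 0 :> R. Proof. by rewrite pnatr_eq0 -lt0n. Qed.

Let Vhat_omega nu mu : (1 <= nu)%N -> (1 <= mu)%N ->
  n%:R * Vhat n X (phi nu) (phi mu) =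
  \sum_(i < n) omega X phi i.+1 nu * omega X phi i.+1 mu.
Proof.
move=> hnu hmu; have [sphi _ _] := hphi.
have -> : Vhat n X (phi nu) (phi mu) =
    n%:R^-1 * \sum_(1 <= i < n.+1) omega X phi i nu * omega X phi i mu.
  apply: (@Rintegral_covariance _ _ _ (@lebesgue_measure R)).
  - exact: measurable_itv.
  - by move=> i; rewrite mem_index_iota ltnS => /hX.
  - exact: sphi.
  - exact: sphi.
by rewrite mulrA mulfV// mul1r big_add1 big_mkord.
Qed.

Lemma Omega_orthogonal : (Omega n X phi)^T *m Omega n X phi = n%:R%:M.
Proof.
have [_ orth _] := hphi.
apply/matrixP => nu mu; rewrite !mxE.
under eq_bigr do rewrite !mxE.
by rewrite -Vhat_omega// orth ?ltn_ord// eqSS mulr_natr.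
Qed.

(** The remainder is r_i = sum over nu > n of b_nu omega_(i,nu). Cauchy-Schwarz with the weights
    nu^k and sum_i omega_(i,nu)^2 <= n give |r|^2 <= n sum_(nu > n) nu^(-2k) <= n / n = 1. *)
Lemma slope_response (k : nat) (b : nat -> R) (beta : R -> R) : (1 <= k)%N ->
  (sobolev_norm k b <= 1)%E -> is_slope phi b beta ->
  exists2 r : 'cV[R]_n,
    \col_i \int[lebesgue_measure]_(t in `[0, 1]) (X i.+1 t * beta t) =
      Omega n X phi *m (\col_nu b nu.+1) + r
    & \sum_i r i 0 ^+ 2 <= 1.
Proof.
move=> k1 hsob [hbeta cvgb]; have [sphi _ tail] := hphi.
pose f i := \int[lebesgue_measure]_(t in `[0, 1]) (X i t * beta t).
pose r : 'cV[R]_n := \col_i f i.+1 - Omega n X phi *m (\col_nu b nu.+1).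
exists r; first by rewrite /r addrC subrK.
(* The bound is proved for these truncated remainders uniformly in [N], then passed to the limit. *)
pose rN N (i : 'I_n) := \sum_(n.+1 <= nu < N.+1) b nu * omega X phi i.+1 nu.
have rcvg i : rN N i @[N --> \oo] --> r i 0.
  have fcvg : \sum_(1 <= nu < N.+1) b nu * omega X phi i.+1 nu @[N --> \oo] --> f i.+1.
    have hXi : square_integrable (X i.+1) by apply: hX; rewrite /= ltn_ord.
    exact: (@inner_product_slope _ _ _ (@lebesgue_measure R) `[0, 1]%classic
      (measurable_itv _) phi b beta (X i.+1) sphi hXi hbeta cvgb).
  have hd : (Omega n X phi *m (\col_nu b nu.+1)) i 0 =
      \sum_(1 <= nu < n.+1) b nu * omega X phi i.+1 nu.
    rewrite big_add1 big_mkord mxE; apply: eq_bigr => nu _.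
    by rewrite !mxE mulrC.
  rewrite /r [X in _ --> X]mxE [X in _ --> X + _]mxE [X in _ --> _ + X]mxE hd.
  have h : \sum_(1 <= nu < N.+1) b nu * omega X phi i.+1 nu -
      \sum_(1 <= nu < n.+1) b nu * omega X phi i.+1 nu @[N --> \oo] -->
      f i.+1 - \sum_(1 <= nu < n.+1) b nu * omega X phi i.+1 nu.
    by apply: cvgB => //; exact: cvg_cst.
  apply: cvg_trans h; apply: near_eq_cvg; exists n => // N /= nN.
  by rewrite /rN (@big_cat_nat _ _ _ n.+1 1 N.+1)//= addrAC subrr add0r.
have rN1 N : \sum_i rN N i ^+ 2 <= 1.
  pose w (nu : nat) : R := nu%:R ^+ k.
  have w0 nu : (n < nu)%N -> w nu != 0.
    by move=> h; rewrite expf_neq0// pnatr_eq0 -lt0n (leq_ltn_trans _ h).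
  apply: (@le_trans _ _ (\sum_(i < n) 1 *
      \sum_(n.+1 <= nu < N.+1) (omega X phi i.+1 nu / w nu) ^+ 2)).
    apply: ler_sum => i _.
    have -> : rN N i = \sum_(n.+1 <= nu < N.+1)
        (b nu * w nu) * (omega X phi i.+1 nu / w nu).
      rewrite /rN !big_nat; apply: eq_bigr => nu /andP[/w0 h _].
      by field.
    apply: le_trans (sum_mul_sqr_le _ _ _) _.
    rewrite ler_wpM2r//; first by apply: sumr_ge0 => nu _; exact: sqr_ge0.
    apply: le_trans (sobolev_partial_sum hsob n N.+1).
    by apply: ler_sum => nu _; rewrite exprMn /w -exprM mulnC.
  under eq_bigr do rewrite mul1r.
  rewrite exchange_big /=.
  apply: (@le_trans _ _ (\sum_(n.+1 <= nu < N.+1) n%:R * (nu%:R ^+ 2)^-1)).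
    rewrite !big_nat; apply: ler_sum => nu /andP[nnu _].
    under eq_bigr do rewrite expr_div_n.
    rewrite -mulr_suml.
    have -> : \sum_(i < n) omega X phi i.+1 nu ^+ 2 = n%:R * Vhat n X (phi nu) (phi nu).
      by rewrite Vhat_omega ?(leq_ltn_trans _ nnu)//; apply: eq_bigr => i _; rewrite expr2.
    have nu1 : 1 <= nu%:R :> R by rewrite ler1n (leq_ltn_trans _ nnu).
    have nup : 0 < nu%:R :> R by exact: lt_le_trans nu1.
    rewrite -mulrA ler_wpM2l//.
    apply: (@le_trans _ _ (1 / w nu ^+ 2)).
      by rewrite ler_wpM2r ?invr_ge0 ?sqr_ge0// tail.
    rewrite div1r lef_pV2 ?posrE ?exprn_gt0// /w -exprM ler_weXn2l//.
    by rewrite -[X in (X <= _)%N]mul1n leq_mul2r.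
  rewrite -mulr_sumr -[X in _ <= X](mulfV nR0) ler_wpM2l//.
  exact: sum_inv_sqr_tail.
have cv : \sum_i rN N i ^+ 2 @[N --> \oo] --> \sum_i r i 0 ^+ 2.
  elim: (index_enum _) => [|i s IH].
    rewrite big_nil; under eq_fun do rewrite big_nil; exact: cvg_cst.
  rewrite big_cons; under eq_fun do rewrite big_cons.
  apply: cvgD IH; rewrite expr2; under eq_fun do rewrite expr2.
  by apply: cvgM; exact: rcvg.
rewrite -(cvg_lim _ cv)//; apply: limr_le; first by apply/cvg_ex; exists (\sum_i r i 0 ^+ 2).
by near=> N; exact: rN1.
Unshelve. all: by end_near. Qed.

End design.

(** * Growth of log log n, of k_n and of the normalizer B_n *)

Section asymptotics.
Context (R : realType).

Lemma near_loglog (M : R) : \forall n \near \oo, M <= loglog R n.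
Proof.
near=> n.
have nM : expR (expR M) <= n%:R by near: n; exact: nbhs_infty_ger.
have n0 : 0 < n%:R :> R by exact: lt_le_trans (expR_gt0 _) nM.
have lnM : expR M <= ln n%:R by rewrite -ler_expR lnK.
have ln0 : 0 < ln n%:R :> R by exact: lt_le_trans (expR_gt0 _) lnM.
by rewrite /loglog -ler_expR lnK.
Unshelve. all: by end_near. Qed.

(** k_n >= c1 (log n)^d0 = c1 exp (d0 log log n) >= c1 d0 log log n, which tends to infinity. *)
Lemma near_log_power_growth (kn : nat -> nat) (d0 M : R) : 0 < d0 ->
  log_power_growth kn d0 -> \forall n \near \oo, M <= (kn n)%:R.
Proof.
move=> d00 [c1 [c2 [c10 c20 H]]].
near=> n.
have L1 : 1 <= loglog R n by near: n; exact: near_loglog.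
have LM : M / (c1 * d0) <= loglog R n by near: n; exact: near_loglog.
have : c1 <= (kn n)%:R / ln n%:R `^ d0 <= c2 by near: n.
case/andP => + _.
have ln0 : 0 < ln n%:R :> R.
  (* [ln] is 0 at nonpositive arguments, so a nonpositive [ln n%:R] would make [loglog R n]
     vanish. *)
  rewrite ltNge; apply/negP => h; move: L1; rewrite /loglog ln0//.
  by rewrite ler10.
have p0 : 0 < ln n%:R `^ d0 :> R by exact: powR_gt0.
rewrite ler_pdivlMr//; apply: le_trans.
move: LM; rewrite ler_pdivrMr ?mulr_gt0// => /le_trans; apply.
rewrite mulrCA ler_pM2l//.
rewrite /powR gt_eqF// -/(loglog R n) mulrC.
by apply: le_trans (expR_ge1Dx _); rewrite lerDr.
Unshelve. all: by end_near. Qed.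

(** If B < 1, then B^2 exp (B^2) <= e, against m^2 > 2 pi e. Once B >= 1, the defining equation
    yields exp (B^2) <= m^2. *)
Lemma normalizer_bounds (m : nat) (B : R) : is_normalizer m B ->
  2 * pi * expR (1 : R) < m%:R ^+ 2 -> 1 <= B /\ B ^+ 2 <= 2 * ln m%:R.
Proof.
move=> [B0 BE] hm.
have pi2 : 2 <= pi :> R by exact: pi_ge2.
have B1 : 1 <= B.
  rewrite leNgt; apply/negP => B1.
  have B21 : B ^+ 2 <= 1 by rewrite expr_le1// ltW.
  move: hm; rewrite ltNge => /negP; apply; rewrite -BE -[2 * pi * B ^+ 2 * _]mulrA.
  rewrite ler_pM2l; last by lra.
  have e1 : expR (B ^+ 2) <= expR 1 by rewrite ler_expR.
  by apply: le_trans e1; rewrite ler_piMl ?expR_ge0.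
split=> //.
have m0 : 0 < m%:R :> R.
  rewrite lt0r pnatr_eq0 ler0n andbT; apply/eqP => m0.
  move: hm; rewrite m0 expr0n/= ltNge mulr_ge0 ?expR_ge0//; lra.
have -> : 2 * ln m%:R = ln (m%:R ^+ 2) :> R by rewrite lnXn// mulr_natl.
rewrite -ler_expR lnK ?posrE ?exprn_gt0// -BE.
rewrite ler_peMl ?expR_ge0//.
have : 1 <= B ^+ 2 by rewrite exprn_ege1.
nra.
Qed.

(** With y = h nu and x = y - h, (1 + x) (1 + y) <= (1 + y)^2 <= 4 (1 + y^(2k)). Each term is thus
    at most 4 / ((1 + x) (1 + y)) = (4 / h) (1 / (1 + x) - 1 / (1 + y)), which telescopes. *)
Lemma sum_inv_le (h : R) (k n : nat) : 0 < h -> (0 < k)%N ->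
  \sum_(1 <= nu < n.+1) 1 / (1 + h ^+ (2 * k) * nu%:R ^+ (2 * k)) <= 4 / h.
Proof.
move=> h0 k0.
suff : \sum_(1 <= nu < n.+1) 1 / (1 + h ^+ (2 * k) * nu%:R ^+ (2 * k)) <=
    4 / h * (1 - (1 + h * n%:R)^-1).
  move/le_trans; apply; have h4 : 0 <= 4 / h by rewrite divr_ge0// ltW.
  rewrite ler_piMr// lerBlDr lerDl.
  by rewrite invr_ge0 addr_ge0// mulr_ge0// ltW.
elim: n => [|n IH]; first by rewrite big_geq// mulr0 addr0 invr1 subrr mulr0.
rewrite big_nat_recr//=; apply: le_trans (lerD IH (lexx _)) _.
have x0 : 0 <= h * n%:R by rewrite mulr_ge0// ltW.
have E : h * n.+1%:R = h * n%:R + h by rewrite -natr1 mulrDr mulr1.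
rewrite -exprMn E; set x := h * n%:R in x0 *; set y := x + h.
have y0 : 0 < y by rewrite /y; lra.
have -> : 4 / h * (1 - (1 + y)^-1) =
    4 / h * (1 - (1 + x)^-1) + 4 / ((1 + x) * (1 + y)).
  by rewrite /y; field; rewrite /y; lra.
rewrite lerD2l.
have Y : y ^+ 2 <= 1 + y ^+ (2 * k).
  have [y1|/ltW y1] := lerP y 1.
    by apply: (@le_trans _ _ 1); rewrite ?expr_le1 ?lerDl ?exprn_ge0// ltW.
  apply: (@le_trans _ _ (y ^+ (2 * k))); last by rewrite lerDr.
  by rewrite ler_weXn2l// -[X in (X <= _)%N]muln1 leq_mul2l.
have D1 : 0 < 1 + y ^+ (2 * k) by rewrite ltr_pwDl// exprn_ge0// ltW.
rewrite ler_pdivrMr// mulrAC ler_pdivlMr ?mulr_gt0//; [|lra..].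
have Yk0 : 0 <= y ^+ (2 * k) by rewrite exprn_ge0// ltW.
have : (1 + x) * (1 + y) <= (1 + y) * (1 + y).
  by rewrite ler_wpM2r; rewrite /y; lra.
have := sqr_ge0 (1 - y); move: Y; rewrite sqrrB expr1n mul1r -mulr_natr !expr2.
by move: Yk0; set Yk := y ^+ _; lra.
Qed.

(** * Exact relations between the separation rate, lambda and the effective dimension *)

Section rates.
Context (n k : nat).
Hypothesis n1 : (1 < n)%N.
Hypothesis k1 : (0 < k)%N.
Hypothesis L1 : 1 <= loglog R n.

(** In terms of [u] and [v], every rate is the exponential of a linear form, so that identities
    between rates become identities between exponents. *)
Let u : R := ln n%:R.
Let v : R := ln (loglog R n).
Let q : R := 4 * k%:R + 1.

Let nE : n%:R = expR u. Proof. by rewrite /u lnK// posrE ltr0n ltnW. Qed.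
Let LE : loglog R n = expR v.
Proof. by rewrite /v lnK// posrE (lt_le_trans _ L1). Qed.
Let q0 : 0 < q. Proof. by rewrite /q ltr_wpDl// mulr_ge0. Qed.
Let u0 : 0 <= u. Proof. by rewrite /u ln_ge0// ler1n ltnW. Qed.
Let v0 : 0 <= v. Proof. by rewrite /v ln_ge0. Qed.

Let powE (x y : R) : expR x `^ y = expR (y * x).
Proof. by rewrite /powR gt_eqF ?expR_gt0// expRK. Qed.

Let deltaE : delta R n k = expR ((k%:R * v - 2 * k%:R * u) / q).
Proof.
rewrite /delta -/q LE nE !powE -expRD; congr expR.
by field; rewrite gt_eqF.
Qed.

Let rateE : n%:R * delta R n k ^+ 2 = expR ((u + 2 * k%:R * v) / q).
Proof.
rewrite deltaE nE -expRM_natl -expRD; congr expR; rewrite /q; field.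
by rewrite -/q gt_eqF.
Qed.

Lemma rate_ge1 : 1 <= n%:R * delta R n k ^+ 2.
Proof. by rewrite rateE -expR0 ler_expR divr_ge0 ?addr_ge0 ?mulr_ge0// ltW. Qed.

Lemma inv_pow_le_delta : (n%:R ^+ (2 * k))^-1 <= delta R n k ^+ 2.
Proof.
have nn : 0 < n%:R :> R by rewrite ltr0n ltnW.
apply: (@le_trans _ _ (n%:R^-1)).
  rewrite lef_pV2 ?posrE ?exprn_gt0// -[X in X <= _]expr1 ler_weXn2l ?ler1n//.
    by rewrite ltnW.
  by rewrite muln_gt0.
by rewrite -(ler_pM2l nn) mulfV ?gt_eqF//; exact: rate_ge1.
Qed.

(** The tuning of [lambda]: the smoothing bias has exactly the order of the squared separation. *)
Lemma lambda_delta (c0 : R) : lambda c0 n k = c0 ^+ (2 * k) * delta R n k ^+ 2.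
Proof.
rewrite /lambda -mulrA; congr (_ * _).
rewrite deltaE -/q LE nE !powE -expRM_natl -expRD; congr expR.
by field; rewrite gt_eqF.
Qed.

Lemma sum_dcoef_le (c0 : R) : 0 < c0 ->
  \sum_(1 <= nu < n.+1) dcoef c0 n k nu <=
  4 / c0 * (n%:R * delta R n k ^+ 2) ^+ 2 / loglog R n.
Proof.
move=> c00.
(* The 2k-th root of [lambda c0 n k], namely c0 (log log n / n^2)^(1 / (4k + 1)). *)
pose h := c0 * expR ((v - 2 * u) / q).
have h0 : 0 < h by rewrite mulr_gt0 ?expR_gt0.
have -> : 4 / c0 * (n%:R * delta R n k ^+ 2) ^+ 2 / loglog R n = 4 / h.
  rewrite rateE LE /h invfM -!mulrA; congr (_ * (_ * _)).
  rewrite -!expRN -!expRD; congr expR.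
  by rewrite /q; field; rewrite -/q gt_eqF.
apply: le_trans (sum_inv_le n h0 k1); apply: ler_sum => nu _.
rewrite /dcoef lambda_delta deltaE.
suff -> : h ^+ (2 * k) = c0 ^+ (2 * k) * expR ((k%:R * v - 2 * k%:R * u) / q) ^+ 2 by [].
rewrite exprMn -!expRM_natl; congr (_ * expR _).
by rewrite natrM; field; rewrite gt_eqF.
Qed.

End rates.
End asymptotics.

(** * Measurability of the test statistic and its domination of each [tau] *)

Lemma measurable_AT d (T : measurableType d) (R : realType) (c0 : R) (n : nat)
    (Om : 'M[R]_n) (kn : nat) (B : R) (y : T -> 'cV[R]_n) :
  (forall i, measurable_fun [set: T] (fun w => y w i 0)) ->
  measurable_fun [set: T] (fun w => AT c0 Om kn B (y w)).
Proof.
move=> my.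
have mtau j : measurable_fun [set: T] (fun w => tau c0 Om (y w) j).
  rewrite /tau; apply: measurable_funM => //; apply: measurable_funB => //.
  apply: measurable_funM => //; rewrite /PLRT; apply: measurable_funM => //.
  set V := invmx _.
  have E w : ((y w)^T *m Om *m V *m Om^T *m y w) 0 0 =
      \sum_i (\sum_l y w l 0 * (Om *m V *m Om^T) l i) * y w i 0.
    rewrite -(mulmxA _ _ Om^T) -(mulmxA _ Om) (mulmxA Om) mxE.
    apply: eq_bigr => i _.
    by rewrite mxE; congr (_ * _); apply: eq_bigr => l _; rewrite mxE.
  under eq_fun do rewrite E.
  apply: measurable_sum => i; apply: measurable_funM => //.
  by apply: measurable_sum => l; apply: measurable_funM.
have mstar : measurable_fun [set: T] (fun w => ATstar c0 Om kn (y w)).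
  rewrite /ATstar; elim: (index_iota 1 kn.+1) => [|j s IH].
    by under eq_fun do rewrite big_nil; exact: mtau.
  by under eq_fun do rewrite big_cons; exact: measurable_maxr.
by rewrite /AT; apply: measurable_funM => //; exact: measurable_funB.
Qed.

Lemma tau_le_ATstar (R : realType) (c0 : R) (n : nat) (Om : 'M[R]_n) (kn k : nat)
    (y : 'cV[R]_n) : (0 < k <= kn)%N -> tau c0 Om y k <= ATstar c0 Om kn y.
Proof.
by move=> hk; apply: le_bigmax_seq => //; rewrite mem_index_iota ltnS.
Qed.

(** * Power of the test at a fixed sample size *)

Section fixed_sample_size.
Context (R : realType) (n k : nat) (X phi : nat -> R -> R) (c0 : R).
Hypothesis n1 : (1 < n)%N.
Hypothesis k1 : (0 < k)%N.
Hypothesis L1 : 1 <= loglog R n.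
Hypothesis c00 : 0 < c0.
Hypothesis hX : forall i, (1 <= i <= n)%N -> square_integrable (X i).
Hypothesis hphi : empirical_eigenfunctions n X phi.

Let n0 : (0 < n)%N. Proof. exact: ltnW. Qed.
Let Om := Omega n X phi.
Let A := Amat c0 Om k.
Let H : R := n%:R * delta R n k ^+ 2.
Let L : R := loglog R n.

Let H1 : 1 <= H. Proof. exact: rate_ge1. Qed.
Let L0 : 0 < L. Proof. exact: lt_le_trans L1. Qed.

Let H0 : 0 < H. Proof. exact: lt_le_trans H1. Qed.

Let lam0 : 0 < lambda c0 n k.
Proof.
rewrite lambda_delta// mulr_gt0 ?exprn_gt0// mulr_gt0// powR_gt0 ?ltr0n//.
Qed.

Let OmO : Om^T *m Om = n%:R%:M. Proof. exact: Omega_orthogonal. Qed.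

Let AE : A = n%:R^-1 *: (Om *m diag_mx (dcoef_row n c0 k) *m Om^T).
Proof. exact: AmatE. Qed.

Let sum_dcoef_row : \sum_nu dcoef_row n c0 k 0 nu = \sum_(1 <= nu < n.+1) dcoef c0 n k nu.
Proof. by rewrite big_add1 big_mkord; apply: eq_bigr => nu _; rewrite mxE. Qed.

Let frobenius_le : \sum_i \sum_l A i l ^+ 2 <= 4 / c0 * H ^+ 2 / L.
Proof.
apply: le_trans (sum_dcoef_le n1 k1 L1 c00); rewrite -sum_dcoef_row AE smoothing_frobenius//.
apply: ler_sum => nu _; have /andP[d0 d1] := dcoef_row_gt0_le1 lam0 nu.
by rewrite expr2 ler_piMr// ltW.
Qed.

(** From C^2 are lost 1 for the coefficients beyond [n], [c0 ^+ (2 * k)] for 1 - d_nu <= lambda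
    nu^(2k), and 2 for the remainder, as |r|^2 <= 1 <= H. *)
Lemma signal_strength (b : nat -> R) (beta : R -> R) (C : R) : 0 <= C ->
  ((C * delta R n k)%:E <= l2_norm b)%E -> (sobolev_norm k b <= 1)%E ->
  is_slope phi b beta ->
  forall f : 'cV[R]_n,
  f = \col_i \int[lebesgue_measure]_(t in `[0, 1]) (X i.+1 t * beta t) ->
  (C ^+ 2 - 3 - c0 ^+ (2 * k)) / 2 * H <= (f^T *m A *m f) 0 0.
Proof.
move=> C0 hl2 hsob hslope f ->.
have [r fE r1] := slope_response n0 hX hphi k1 hsob hslope.
have d0 : 0 <= delta R n k by rewrite mulr_ge0 ?powR_ge0.
have := smoothing_signal n0 OmO (dcoef_row_gt0_le1 lam0) fE; rewrite -AE.
apply: le_trans.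
have hb := l2_norm_head hsob n0 (mulr_ge0 C0 d0) hl2.
have hs := sobolev_partial_sum hsob 0 n.+1.
set s := \sum_nu _.
have sb : C ^+ 2 * delta R n k ^+ 2 - delta R n k ^+ 2 -
    c0 ^+ (2 * k) * delta R n k ^+ 2 <= s.
  have : \sum_(1 <= nu < n.+1) b nu ^+ 2 -
      lambda c0 n k * \sum_(1 <= nu < n.+1) b nu ^+ 2 * nu%:R ^+ (2 * k) <= s.
    rewrite mulr_sumr -sumrB big_add1 big_mkord; apply: ler_sum => nu _.
    rewrite !mxE /dcoef; set x := _ ^+ 2; set z := nu.+1%:R ^+ _.
    have x0 : 0 <= x by exact: sqr_ge0.
    have z0 : 0 <= lambda c0 n k * z by rewrite mulr_ge0 ?exprn_ge0// ltW.
    have -> : x - lambda c0 n k * (x * z) = (1 - lambda c0 n k * z) * x by ring.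
    rewrite ler_wpM2r// ler_pdivlMr; nra.
  have : lambda c0 n k * \sum_(1 <= nu < n.+1) b nu ^+ 2 * nu%:R ^+ (2 * k)
      <= lambda c0 n k by rewrite ler_piMr// ltW.
  rewrite {2}lambda_delta//; have := inv_pow_le_delta n1 k1 L1.
  by move: hb; rewrite exprMn; lra.
have nn : 0 < n%:R :> R by rewrite ltr0n.
have : n%:R / 2 * (C ^+ 2 * delta R n k ^+ 2 - delta R n k ^+ 2 -
    c0 ^+ (2 * k) * delta R n k ^+ 2) <= n%:R / 2 * s.
  by rewrite ler_wpM2l// divr_ge0// ltW.
move: H1; rewrite /H; set D := delta R n k ^+ 2; set c := c0 ^+ _; set CC := C ^+ 2.
move: r1; set rr := \sum_i _ => r1 h1 h2.
have -> : (CC - 3 - c) / 2 * (n%:R * D) =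
  n%:R / 2 * (CC * D - D - c * D) - n%:R * D by field.
by lra.
Qed.

(** Were the off-diagonal sum zero, [smoothing_diagonal_row] would produce a column of Omega whose
    fourth powers sum to at least n^2. The upper bound is that of the full Frobenius norm. *)
Lemma normalization_bounds :
  \big[Num.max/0]_(1 <= nu < n.+1) \sum_(1 <= i < n.+1) omega X phi i nu ^+ 4
    < n%:R ^+ 2 ->
  0 < 2 * \sum_(i < n) \sum_(l < n | l != i) A i l ^+ 2 <= 8 / c0 * H ^+ 2 / L.
Proof.
move=> h4; apply/andP; split; last first.
  have : \sum_(i < n) \sum_(l < n | l != i) A i l ^+ 2 <= 4 / c0 * H ^+ 2 / L.
    apply: le_trans frobenius_le; apply: ler_sum => i _.
    by rewrite [X in _ <= X](bigD1 i)//= lerDr sqr_ge0.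
  have -> : 8 / c0 * H ^+ 2 / L = 2 * (4 / c0 * H ^+ 2 / L) by ring.
  by lra.
rewrite mulr_gt0// lt_neqAle eq_sym; apply/andP; split; last first.
  by do 2 apply: sumr_ge0 => ? _; exact: sqr_ge0.
apply/negP => /eqP s0.
have Adiag i l : l != i -> A i l = 0.
  move=> li; apply/eqP; rewrite -sqrf_eq0; apply/eqP.
  have i0 : \sum_(l < n | l != i) A i l ^+ 2 = 0.
    move: s0 => /psumr_eq0P; apply => // j _.
    by apply: sumr_ge0 => ? _; exact: sqr_ge0.
  by move: i0 => /psumr_eq0P; apply => // j _; exact: sqr_ge0.
rewrite AE in Adiag.
have [nu] := smoothing_diagonal_row n0 OmO (dcoef_row_inj lam0 k1) Adiag.
apply/negP; rewrite -ltNge; apply: le_lt_trans h4.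
have -> : \sum_i Om i nu ^+ 4 = \sum_(1 <= i < n.+1) omega X phi i nu.+1 ^+ 4.
  by rewrite big_add1 big_mkord; apply: eq_bigr => i _; rewrite mxE.
by apply: (@le_bigmax_seq _ _ _ _ _ nu.+1) => //; rewrite mem_index_iota /= ltnS ltn_ord.
Qed.

Context d (T : measurableType d) (P : probability T R).
Context (eps : nat -> {RV P >-> R}).
Context (K Q K0 C eta alpha B : R) (kn : nat).
Hypothesis K1 : 1 <= K.
Hypothesis tailK : forall (A : 'M[R]_n) (v : 'I_n -> R) (a : R), 0 < a ->
  (P [set w | (\sum_i v i * eps i.+1 w +
      (\sum_i \sum_l A i l * (eps i.+1 w * eps l.+1 w) - \tr A) <= - a)%R]
   <= ((4 * \sum_i v i ^+ 2 + 4 * K * \sum_i \sum_l A i l ^+ 2) / a ^+ 2)%:E)%E.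
Hypothesis B1 : 1 <= B.
Hypothesis BQ : (B + `|critical_value alpha|) ^+ 2 <= Q * L.
Hypothesis eta0 : 0 < eta.
Hypothesis K0ge1 : 1 <= K0.
Hypothesis K0eta : 128 / eta <= K0.
Hypothesis K0K : 128 * K / (c0 * eta) <= K0.
Hypothesis K0Q : 33 * Q / c0 <= K0.
Hypothesis Q0 : 0 < Q.
Hypothesis CE : K0 = (C ^+ 2 - 3 - c0 ^+ (2 * k)) / 2.
Hypothesis C0 : 0 <= C.
Hypothesis kkn : (k <= kn)%N.
Hypothesis h4 :
  \big[Num.max/0]_(1 <= nu < n.+1) \sum_(1 <= i < n.+1) omega X phi i nu ^+ 4
    < n%:R ^+ 2.

(** Outside the event W <= - S / 2 the numerator of [tau] exceeds S / 2, which is already above the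
    threshold; that event has probability at most [eta] by [tailK]. *)
Lemma rejection_probability (b : nat -> R) (beta : R -> R) :
  ((C * delta R n k)%:E <= l2_norm b)%E -> (sobolev_norm k b <= 1)%E ->
  is_slope phi b beta ->
  ((1 - eta)%:E <= P (rejection_event c0 n X phi kn B alpha beta eps))%E.
Proof.
move=> hl2 hsob hslope.
pose f : 'cV[R]_n :=
  \col_i \int[lebesgue_measure]_(t in `[0, 1]) (X i.+1 t * beta t).
have := signal_strength C0 hl2 hsob hslope (erefl f); rewrite -CE.
set S := (_ *m _) 0 0 => SH.
have K00 : 0 < K0 by exact: lt_le_trans K0ge1.
have /andP[s0 sH] := normalization_bounds h4.
set ss := 2 * _ in s0 sH.
pose v i := 2 * (A *m f) i 0.
pose W w := \sum_i v i * eps i.+1 w +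
  (\sum_i \sum_l A i l * (eps i.+1 w * eps l.+1 w) - \tr A).
have S0 : 0 < S by apply: lt_le_trans SH; exact: mulr_gt0.
have vS : \sum_i v i ^+ 2 <= 4 * S.
  under eq_bigr do rewrite exprMn.
  rewrite -mulr_sumr (_ : 2 ^+ 2 = 4); last by ring.
  rewrite ler_pM2l// /S AE.
  exact: (smoothing_drift n0 OmO (dcoef_row_gt0_le1 lam0)).
have AH : \sum_i \sum_l A i l ^+ 2 <= 4 / c0 * H ^+ 2.
  apply: le_trans frobenius_le _; rewrite ler_pdivrMr// ler_peMr//.
  by rewrite mulr_ge0 ?sqr_ge0// divr_ge0// ltW.
have tauE w : tau c0 Om (response n X beta eps w) k = (S + W w) / Num.sqrt ss.
  rewrite /tau PLRTE//.
  suff -> : ((response n X beta eps w)^T *m Amat c0 Om k *m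
      response n X beta eps w) 0 0 -
      \sum_(1 <= nu < n.+1) dcoef c0 n k nu = S + W w by [].
  have epsE i : (\col_i eps i.+1 w : 'cV[R]_n) i 0 = eps i.+1 w by rewrite mxE.
  have -> : response n X beta eps w = f + \col_i eps i.+1 w.
    by apply/colP => i; rewrite !mxE.
  rewrite quadratic_expand; last by rewrite AmatE// smoothing_sym.
  rewrite -/A -/S -addrA; congr (_ + _).
  rewrite -sum_dcoef_row -(smoothing_trace _ n0 OmO) -AE /W addrA; congr (_ + _ - _).
    by apply: eq_bigr => i _; rewrite epsE.
  by do 2 apply: eq_bigr => ? _; rewrite !epsE.
have mW : measurable_fun [set: T] W.
  apply: measurable_funD.
    by apply: measurable_sum => i; exact: measurable_funM.
  apply: measurable_funB => //.
  apply: measurable_sum => i; apply: measurable_sum => l.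
  by apply: measurable_funM => //; exact: measurable_funM.
have mE : measurable [set w | W w <= - (S / 2)].
  by rewrite -[X in measurable X]setTI; exact: measurable_fun_le.
have mrej : measurable (rejection_event c0 n X phi kn B alpha beta eps).
  pose F w := AT c0 Om kn B (response n X beta eps w).
  have -> : rejection_event c0 n X phi kn B alpha beta eps = F @^-1` `]critical_value alpha, +oo[.
    by apply/seteqP; split=> w /=; rewrite in_itv/= andbT.
  rewrite -[X in measurable X]setTI.
  suff mF : measurable_fun [set: T] F by apply: mF => //; exact: measurable_itv.
  apply: measurable_AT => i.
  by under eq_fun do rewrite mxE; exact: measurable_funD.
have rej : ~` [set w | W w <= - (S / 2)] `<=`
    rejection_event c0 n X phi kn B alpha beta eps.
  move=> w /= /negP; rewrite -ltNge => Ww.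
  rewrite /rejection_event /= /AT.
  set ca := critical_value alpha.
  (* Since [1 <= B], multiplying the positive excess [ATstar - B] by [B] only enlarges it. *)
  suff tB : B + `|ca| < tau c0 Om (response n X beta eps w) k.
    have := tau_le_ATstar c0 Om (response n X beta eps w) (k := k) (kn := kn).
    rewrite k1 kkn => /(_ isT) h.
    have z0 : `|ca| < ATstar c0 Om kn (response n X beta eps w) - B by lra.
    apply: le_lt_trans (ler_norm ca) _.
    apply: lt_le_trans z0 _; rewrite ler_peMl//.
    by apply: le_trans (normr_ge0 ca) _; lra.
  rewrite tauE ltr_pdivlMr ?sqrtr_gt0//.
  apply: (@le_lt_trans _ _ (S / 2)); last by lra.
  have BB0 : 0 <= (B + `|ca|) * Num.sqrt ss.
    by rewrite mulr_ge0 ?sqrtr_ge0// addr_ge0// (le_trans ler01).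
  rewrite -ler_sqr ?nnegrE//; last by lra.
  rewrite exprMn sqr_sqrtr; last exact: ltW.
  (* The factor [L] in the bound on the squared threshold cancels the 1 / [L] in the bound on [ss].
     The constant 33 in [K0Q] is then enough because K0^2 / 4 >= K0 / 4 and 33 / 4 > 8. *)
  apply: (@le_trans _ _ (8 * Q / c0 * H ^+ 2)).
    apply: (@le_trans _ _ (Q * L * (8 / c0 * H ^+ 2 / L))).
      by rewrite ler_pM ?sqr_ge0// ltW.
    by rewrite le_eqVlt; apply/orP; left; apply/eqP; field; rewrite !gt_eqF.
  apply: (@le_trans _ _ ((K0 * H / 2) ^+ 2)); last first.
    rewrite ler_sqr ?nnegrE; [|by rewrite divr_ge0// mulr_ge0// ltW|by lra].
    by rewrite ler_wpM2r.
  have -> : (K0 * H / 2) ^+ 2 = K0 ^+ 2 / 4 * H ^+ 2 by field.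
  rewrite ler_wpM2r ?sqr_ge0//.
  have Qc : 0 < Q / c0 by rewrite divr_gt0.
  have hq : 33 * (Q / c0) <= K0 by rewrite mulrA.
  have -> : 8 * Q / c0 = 8 * (Q / c0) by rewrite mulrA.
  have K02 : K0 <= K0 ^+ 2 by rewrite expr2 ler_peMr// ltW.
  by move: K02 hq Qc; set qc := Q / c0; set K2 := K0 ^+ 2; lra.
have PE : (P [set w | (W w <= - (S / 2))%R] <= eta%:E)%E.
  have S20 : 0 < S / 2 by rewrite divr_gt0.
  apply: le_trans (tailK A v S20) _; rewrite lee_fin.
  rewrite ler_pdivrMr ?exprn_gt0//.
  have c0e : 0 < c0 * eta by rewrite mulr_gt0.
  have e1 : 128 <= K0 * eta by move: K0eta; rewrite ler_pdivrMr.
  have e2 : 128 * K <= K0 * (c0 * eta) by move: K0K; rewrite ler_pdivrMr.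
  (* The linear part contributes at most 16 S and the quadratic part at most 16 K H^2 / c0. Each is
     at most eta S^2 / 8, so the total stays within eta (S / 2)^2. *)
  have SS : 128 * S <= eta * S ^+ 2.
    rewrite expr2 mulrA ler_pM2r//; apply: le_trans e1 _.
    rewrite mulrC ler_pM2l//; apply: le_trans SH; rewrite ler_peMr// ltW//.
  have HH : 128 * K / c0 * H ^+ 2 <= eta * S ^+ 2.
    apply: (@le_trans _ _ (eta * (K0 * H) ^+ 2)); last first.
      by rewrite ler_pM2l// ler_sqr ?nnegrE// ltW// mulr_gt0.
    rewrite [(K0 * H) ^+ 2]exprMn [X in _ <= X]mulrA ler_wpM2r ?sqr_ge0// ler_pdivrMr//.
    apply: le_trans e2 _; rewrite expr2 [X in _ <= X](_ : _ = K0 * (c0 * eta) * K0).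
      by rewrite ler_peMr// ltW// mulr_gt0.
    by ring.
  have AK : 4 * K * \sum_i \sum_l A i l ^+ 2 <= 4 * K * (4 / c0 * H ^+ 2).
    by rewrite ler_wpM2l// mulr_ge0// (le_trans ler01).
  have E1 : 4 * K * (4 / c0 * H ^+ 2) = (128 * K / c0 * H ^+ 2) / 8.
    by field; rewrite gt_eqF.
  have E2 : eta * (S / 2) ^+ 2 = eta * S ^+ 2 / 4 by field.
  by rewrite E2; move: AK vS; rewrite E1; lra.
apply: (@le_trans _ _ (P (~` [set w | W w <= - (S / 2)]))).
  by rewrite probability_setC//= EFinB; apply: leeB.
by apply: le_measure rej; rewrite inE//; exact: measurableC.
Qed.

End fixed_sample_size.

(** * Choice of the constants and passage to large sample sizes *)

Theorem theorem6p4 (R : realType)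
  (d : measure_display) (T : measurableType d) (P : probability T R)
  (* errors: eps_1, eps_2, ... i.i.d. copies of e *)
  (e : {RV P >-> R}) (eps : nat -> {RV P >-> R})
  (* design X_(n,1), ..., X_(n,n) and empirical eigenfunctions at sample size n *)
  (X phi : nat -> nat -> R -> R)
  (c0 alpha d0 : R) (kn : nat -> nat) (B : nat -> R) (k : nat)
  (heps : iid_copies e eps)
  (hmean : ('E_P[e] = 0)%E)
  (hsd : (sqrte 'V_P[e] = 1)%E)
  (hX : forall n i : nat, (1 <= i <= n)%N -> square_integrable (X n i))
  (hphi : forall n : nat, (1 <= n)%N -> empirical_eigenfunctions n (X n) (phi n))
  (hc0 : 0 < c0)
  (halpha : 0 < alpha < 1)
  (hk : (1 <= k)%N)
  (hd0 : 0 < d0 < 1 / 2)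
  (hkn : log_power_growth kn d0)
  (hB : forall n : nat, is_normalizer (kn n) (B n))
  (hsub : sub_gaussian e)
  (homega : max_fourth_moment X phi =o_\oo
     (fun n : nat => n%:R `^ (8 / 5) * loglog R n `^ (- (14 / 5)))) :
  forall eta : R, 0 < eta < 1 ->
  exists (N : nat) (C : R), [/\ (0 < N)%N, 0 < C &
    forall n : nat, (N <= n)%N ->
      ((1 - eta)%:E <=
       ereal_inf [set p | exists (b : nat -> R) (beta : R -> R),
         [/\ (C * delta R n k)%:E <= l2_norm b,
             sobolev_norm k b <= 1,
             is_slope (phi n) b beta
           & p = P (rejection_event c0 n (X n) (phi n) (kn n) (B n) alpha
                                    beta eps)]])%E].
Proof.
move=> eta /andP[eta0 eta1].
have [K K1 tailK] := quadratic_form_lower_tail heps hmean hsd hsub.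
have [c1 [c2 [c10 c20 hc]]] := hkn.
have [d00 d01] := andP hd0.
pose ca : R := `|critical_value alpha|.
(* From (B + ca)^2 <= 2 B^2 + 2 ca^2, B^2 <= 2 log k_n and log k_n <= log c2 + d0 log log n with d0
   < 1 / 2, when log log n >= 1. *)
pose Q : R := 4 * `|ln c2| + 2 + 2 * ca ^+ 2.
have ca0 : 0 <= ca by exact: normr_ge0.
have Q0 : 0 < Q by rewrite /Q; have := sqr_ge0 ca; have := normr_ge0 (ln c2); lra.
(* The summands serve in turn [1 <= K0], the variance of the linear noise, that of the quadratic
   noise, and the rejection threshold. *)
pose K0 : R := 1 + 128 / eta + 128 * K / (c0 * eta) + 33 * Q / c0.
have K00 : 0 < K by exact: lt_le_trans K1.
have t1 : 0 <= 128 / eta by rewrite divr_ge0// ltW.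
have t2 : 0 <= 128 * K / (c0 * eta) by rewrite divr_ge0 ?mulr_ge0// ltW.
have t3 : 0 <= 33 * Q / c0 by rewrite divr_ge0 ?mulr_ge0// ltW.
(* The value of C^2 at which [signal_strength] yields the factor [K0]. *)
pose CC : R := 2 * K0 + 3 + c0 ^+ (2 * k).
have ck0 : 0 < c0 ^+ (2 * k) by exact: exprn_gt0.
have CC0 : 0 < CC by rewrite /CC /K0; lra.
have near_all : \forall n \near \oo, forall (b : nat -> R) (beta : R -> R),
    ((Num.sqrt CC * delta R n k)%:E <= l2_norm b)%E ->
    (sobolev_norm k b <= 1)%E -> is_slope (phi n) b beta ->
    ((1 - eta)%:E <= P (rejection_event c0 n (X n) (phi n) (kn n) (B n) alpha
       beta eps))%E.
  near=> n => b beta hl2 hsob hslope.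
  have n2 : (1 < n)%N by near: n; exact: nbhs_infty_gt.
  have n0 : (0 < n)%N by exact: ltnW.
  have L1 : 1 <= loglog R n by near: n; exact: near_loglog.
  have kk : k%:R <= (kn n)%:R :> R by near: n; exact: near_log_power_growth hkn.
  (* With k_n >= M > 1, k_n^2 >= k_n > 2 pi e, as [normalizer_bounds] requires. *)
  pose M : R := 2 * pi * expR 1 + 1.
  have knM : M <= (kn n)%:R by near: n; exact: near_log_power_growth hkn.
  have hc2 : c1 <= (kn n)%:R / ln n%:R `^ d0 <= c2 by near: n.
  have hom : `|max_fourth_moment X phi n| <=
      1 * `|n%:R `^ (8 / 5) * loglog R n `^ (- (14 / 5))|.
    by near: n; move/eqoP : homega; apply.
  have M0 : 0 < 2 * pi * expR 1 :> R by rewrite !mulr_gt0 ?pi_gt0 ?expR_gt0.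
  have M1 : 1 < (kn n)%:R :> R by apply: lt_le_trans knM; rewrite /M; lra.
  have kM : 2 * pi * expR (1 : R) < (kn n)%:R ^+ 2.
    apply: (@lt_le_trans _ _ (kn n)%:R); first by apply: lt_le_trans knM; rewrite /M; lra.
    by rewrite expr2 ler_peMr// ltW.
  have [B1 BL] := normalizer_bounds (hB n) kM.
  refine (@rejection_probability R n k (X n) (phi n) c0 n2 hk L1 hc0 (hX n)
    (hphi n n0) d T P eps K Q K0 (Num.sqrt CC) eta alpha (B n) (kn n) K1 (tailK n)
    B1 _ eta0 _ _ _ _ Q0 _ (sqrtr_ge0 _) _ _ b beta hl2 hsob hslope).
  - rewrite -/ca.
    have L0 : 0 < ln n%:R :> R.
      rewrite ltNge; apply/negP => h; move: L1; rewrite /loglog ln0//.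
      by rewrite ler10.
    have p0 : 0 < ln n%:R `^ d0 :> R by exact: powR_gt0.
    have lk : ln (kn n)%:R <= ln c2 + d0 * loglog R n.
      rewrite /loglog -ln_powR -lnM ?posrE// ler_ln ?posrE ?mulr_gt0//; last first.
        exact: lt_trans M1.
      by move: hc2 => /andP[_]; rewrite ler_pdivrMr.
    have lL : ln c2 <= `|ln c2| * loglog R n.
      by apply: le_trans (ler_norm _) _; rewrite ler_peMr.
    have dL : d0 * loglog R n <= 1 / 2 * loglog R n.
      by rewrite ler_wpM2r ?(le_trans ler01)// ltW.
    have cL : ca ^+ 2 <= ca ^+ 2 * loglog R n by rewrite ler_peMr ?sqr_ge0.
    have := sqr_ge0 (B n - ca); rewrite sqrrB sqrrD.
    by rewrite /Q; move: BL lk lL dL cL; lra.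
  - by rewrite /K0; lra.
  - by rewrite /K0; lra.
  - by rewrite /K0; lra.
  - by rewrite /K0; lra.
  - by rewrite sqr_sqrtr ?(ltW CC0)// /CC; field.
  - by move: kk; rewrite ler_nat.
  (* The little-o with constant 1, together with log log n >= 1, bounds the maximum by n^(8/5) <
     n^2. *)
  - move: hom; rewrite /max_fourth_moment mul1r => /(le_trans (ler_norm _)).
    move/le_lt_trans; apply.
    rewrite ger0_norm; last by rewrite mulr_ge0 ?powR_ge0.
    have nn : 1 < n%:R :> R by rewrite ltr1n.
    apply: (@le_lt_trans _ _ (n%:R `^ (8 / 5))).
      rewrite ler_piMr ?powR_ge0// -[X in _ <= X](powRr0 (loglog R n)).
      by apply: ler_powR => //; lra.
    rewrite -powR_mulrn// /powR gt_eqF ?(lt_trans ltr01)//.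
    by rewrite ltr_expR ltr_pM2r ?ln_gt0//; lra.
have [N _ hN] := near_all.
(* The successor makes the threshold positive. *)
exists N.+1, (Num.sqrt CC); split=> //; first by rewrite sqrtr_gt0.
move=> n Nn; apply/ereal_infP => _ [b [beta [hl2 hsob hslope ->]]].
exact: (hN n (ltnW Nn)) hl2 hsob hslope.
Unshelve. all: by end_near. Qed.
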